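(* Let $\mathcal{G}$ be an ideal of graphs and let $\mathcal{A}$ be the class of all forests. Then the following are equivalent. 1. $\nu_{\mathcal{A}}$ is bounded on $\mathcal{G}$. 2. $e_{\mathcal{A}}$ is bounded on $\mathcal{G}$. 3. $\eta_{\mathcal{A}}$ is bounded on $\mathcal{G}$. 4. $\operatorname{FAN}(K_3,S) \not\subseteq \mathcal{G}$ for every $S \subseteq V(K_3)$ with $|S| \leq 2$.
   Context: All graphs are finite and simple. $H$ is a topological minor of $G$ if $G$ has a subgraph isomorphic to a subdivision of $H$ (edges replaced by internally disjoint paths of length at least $1$). An ideal is a class of graphs closed under isomorphisms and taking topological minors. For a class $\mathcal{C}$ of graphs closed under isomorphisms and subgraphs (such as $\mathcal{A}$) and a graph $G$: - $e_{\mathcal{C}}(G)$ (edit distance) is the minimum of $|E(G')\triangle E(G)|$ over all $G'\in\mathcal{C}$ with $V(G')=V(G)$; equivalently, the minimum number of edges whose deletion from $G$ gives a graph in $\mathcal{C}$. - $\eta_{\mathcal{C}}(G)$ ($\mathcal{C}$-edge-brittleness) is the minimum $\ell$ such that there is a partition $(V_1,\dots,V_n)$ of $V(G)$ with the induced subgraph $G[V_i]\in\mathcal{C}$ for all $i$ and exactly $\ell$ edges of $G$ having ends in distinct $V_i$'s. - $\nu_{\mathcal{C}}(G)$ ($\bar{\mathcal{C}}$-capacity) is the maximum $\ell$ such that there exist pairwise edge-disjoint subgraphs $H_1,\dots,H_\ell$ of $G$ with $H_i\notin\mathcal{C}$ for each $i$. A graph parameter $f$ is bounded on a class $\mathcal{G}$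 if there is a constant $M$ with $|f(G)|\le M$ for all $G\in\mathcal{G}$. For a graph $G$, $S\subsetneq V(G)$ and a positive integer $k$, $\operatorname{Fan}(G,S,k)$ is the graph obtained from $k$ vertex-disjoint copies of $G$ by identifying all the copies of $v$ for each $v\in S$ and identifying all the copies of $e$ for each $e\in E(G[S])$. $\operatorname{FAN}(G,S)$ is the ideal of all graphs isomorphic to a topological minor of $\operatorname{Fan}(G,S,k)$ for some positive integer $k$. *)

(* Defs.v *)
From HB Require Import structures.
From mathcomp Require Import boolp classical_sets.
From mathcomp Require Import all_boot.

Set Implicit Arguments.
Unset Strict Implicit.
Unset Printing Implicit Defensive.

(* classical_sets comes before all_boot so that cover, partition and the set    *)
(* notations are those of finset.                                              *)

Record sgraph := SGraph {
  vert :> finType;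
  adj : rel vert;
  adj_sym : symmetric adj;
  adj_irr : irreflexive adj }.

Definition edges (G : sgraph) : {set {set G}} :=
  [set [set p.1; p.2] | p : G * G & adj p.1 p.2].

Definition isomorphic (G H : sgraph) : Prop :=
  exists2 f : G -> H, bijective f & forall x y, adj (f x) (f y) = adj x y.

Lemma induced_sym (G : sgraph) (W : {set G}) :
  symmetric (fun x y : {x : G | x \in W} => adj (val x) (val y)).
Proof. by move=> x y; rewrite adj_sym. Qed.

Lemma induced_irr (G : sgraph) (W : {set G}) :
  irreflexive (fun x y : {x : G | x \in W} => adj (val x) (val y)).
Proof. by move=> x; rewrite adj_irr. Qed.

Definition induced (G : sgraph) (W : {set G}) : sgraph :=
  SGraph (@induced_sym G W) (@induced_irr G W).

Record subgraph (G : sgraph) := Subgraph {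
  sub_vert : {set G};
  sub_edge : {set {set G}};
  sub_edge_edges : sub_edge \subset edges G;
  sub_edge_vert : cover sub_edge \subset sub_vert }.

Lemma set1_notin_edges (G : sgraph) (x : G) : [set x; x] \notin edges G.
Proof.
apply/imsetP => -[[y z]]; rewrite inE /= => yz E.
have := set21 y z; have := set22 y z; rewrite -E setUid !inE => /eqP zx /eqP yx.
by move: yz; rewrite zx yx adj_irr.
Qed.

Lemma sub_graph_sym (G : sgraph) (H : subgraph G) :
  symmetric (fun x y : {x : G | x \in sub_vert H} =>
               [set val x; val y] \in sub_edge H).
Proof. by move=> x y; rewrite setUC. Qed.

Lemma sub_graph_irr (G : sgraph) (H : subgraph G) :
  irreflexive (fun x y : {x : G | x \in sub_vert H} =>
                 [set val x; val y] \in sub_edge H).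
Proof.
move=> x; apply/negP => /(subsetP (sub_edge_edges H)).
exact/negP/set1_notin_edges.
Qed.

Definition sub_graph (G : sgraph) (H : subgraph G) : sgraph :=
  SGraph (@sub_graph_sym G H) (@sub_graph_irr G H).

Coercion sub_graph : subgraph >-> sgraph.

(* phi gives the branch vertices and P x y the inner vertices, listed from x   *)
(* to y, of the path replacing the edge xy (nil when that path has length 1);  *)
(* the values of P x y for non-adjacent x, y are irrelevant. The last two      *)
(* clauses say that K has no other vertices and no other edges.                *)
Definition is_subdivision (K H : sgraph) : Prop :=
  exists (phi : H -> K) (P : H -> H -> seq K),
    let route x y := phi x :: rcons (P x y) (phi y) in
    [/\ injective phi,
        forall x y, adj x y -> P y x = rev (P x y),
        forall x y, adj x y ->
          [/\ path (@adj K) (phi x) (rcons (P x y) (phi y)),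
              uniq (route x y)
            & forall z, phi z \notin P x y],
        forall x y x' y', adj x y -> adj x' y' ->
          [set x; y] != [set x'; y'] -> forall w, w \in P x y -> w \notin P x' y'
      & (forall w, (exists x, w = phi x) \/
                   (exists x y, adj x y /\ w \in P x y)) /\
        (forall u v, adj u v ->
           exists x y, adj x y /\ infix [:: u; v] (route x y))].

Definition topological_minor (H G : sgraph) : Prop :=
  exists (K : sgraph) (G' : subgraph G), is_subdivision K H /\ isomorphic K G'.

Definition graph_class := sgraph -> Prop.

Definition subclass (Fs Gs : graph_class) : Prop := forall G, Fs G -> Gs G.

Definition ideal (Gs : graph_class) : Prop :=
  (forall G H, Gs G -> isomorphic G H -> Gs H) /\
  (forall G H, Gs G -> topological_minor H G -> Gs H).

Definition forest : graph_class := fun G =>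
  forall c : seq G, ~ [/\ 2 < size c, uniq c & cycle (@adj G) c].

(* The value is 0 when P has no least (resp. greatest) element.                *)
Definition minimum (P : nat -> Prop) : nat :=
  xget 0 (fun m => P m /\ forall n, P n -> m <= n).

Definition maximum (P : nat -> Prop) : nat :=
  xget 0 (fun m => P m /\ forall n, P n -> n <= m).

Lemma minimumP (P : nat -> Prop) :
  (exists n, P n) -> P (minimum P) /\ forall n, P n -> minimum P <= n.
Proof.
move=> [n Pn]; apply: (@xgetPex nat 0 (fun m => P m /\ forall n, P n -> m <= n)).
have exP : exists n, `[<P n>] by exists n; apply/asboolP.
exists (ex_minn exP); case: ex_minnP => m /asboolP Pm m_min.
by split=> // k /asboolP/m_min.
Qed.

Lemma maximumP (P : nat -> Prop) (b : nat) :
  (exists n, P n) -> (forall n, P n -> n <= b) ->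
  P (maximum P) /\ forall n, P n -> n <= maximum P.
Proof.
move=> [n Pn] Pb.
apply: (@xgetPex nat 0 (fun m => P m /\ forall n, P n -> n <= m)).
have exP : exists n, `[<P n>] by exists n; apply/asboolP.
have ubP k : `[<P k>] -> k <= b by move=> /asboolP/Pb.
exists (ex_maxn exP ubP); case: ex_maxnP => m /asboolP Pm m_max.
by split=> // k /asboolP/m_max.
Qed.

Definition edit_distance (C : graph_class) (G : sgraph) : nat :=
  minimum (fun l =>
    exists (e : rel G) (e_sym : symmetric e) (e_irr : irreflexive e),
      let G' := SGraph e_sym e_irr in
      let E' : {set {set G}} := edges G' in
      C G' /\ #|(E' :\: edges G) :|: (edges G :\: E')| = l).

Definition edge_brittleness (C : graph_class) (G : sgraph) : nat :=
  minimum (fun l =>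
    exists P : {set {set G}},
      [/\ partition P [set: G],
          forall B, B \in P -> C (induced B)
        & #|[set e in edges G |
              [exists x in e, exists y in e, pblock P x != pblock P y]]| = l]).

Definition capacity (C : graph_class) (G : sgraph) : nat :=
  maximum (fun l =>
    exists H : 'I_l -> subgraph G,
      (forall i j, i != j -> [disjoint sub_edge (H i) & sub_edge (H j)]) /\
      (forall i, ~ C (H i))).

Definition bounded_on (f : sgraph -> nat) (Gs : graph_class) : Prop :=
  exists M, forall G, Gs G -> f G <= M.

Section Fan.
Variables (G : sgraph) (S : {set G}) (k : nat).

(* inl s is the common vertex s of the k copies; inr (i, v) is the i-th copy   *)
(* of a vertex v outside S.                                                    *)
Definition fan_vert : finType :=
  ({x : G | x \in S} + 'I_k * {x : G | x \notin S})%type.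

Definition fan_base (p : fan_vert) : G :=
  match p with inl s => val s | inr q => val q.2 end.

Definition fan_same_copy (p q : fan_vert) : bool :=
  match p, q with inr p', inr q' => p'.1 == q'.1 | _, _ => true end.

Definition fan_adj : rel fan_vert :=
  fun p q => adj (fan_base p) (fan_base q) && fan_same_copy p q.

Lemma fan_adj_sym : symmetric fan_adj.
Proof.
by move=> [s|p] [t|q]; rewrite /fan_adj /= adj_sym // eq_sym.
Qed.

Lemma fan_adj_irr : irreflexive fan_adj.
Proof. by move=> p; rewrite /fan_adj adj_irr. Qed.

Definition Fan : sgraph := SGraph fan_adj_sym fan_adj_irr.

End Fan.

Definition FAN (G : sgraph) (S : {set G}) : graph_class := fun H =>
  exists k, 0 < k /\ topological_minor H (Fan S k).

Lemma complete_sym n : symmetric (fun i j : 'I_n => i != j).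
Proof. by move=> i j; rewrite eq_sym. Qed.

Lemma complete_irr n : irreflexive (fun i j : 'I_n => i != j).
Proof. by move=> i; rewrite eqxx. Qed.

Definition complete (n : nat) : sgraph := SGraph (@complete_sym n) (@complete_irr n).

(* Main.v *)
(* The substance is (4) => (2), (3). Suppose that every graph of the ideal      *)
(* excludes k disjoint triangles, k triangles sharing a vertex and k triangles *)
(* sharing an edge. If a connected subgraph of G - x contains many neighbours  *)
(* of x, then a spanning tree of it has either many disjoint branches with two *)
(* neighbours of x each (triangles sharing x) or a vertex u from which many    *)
(* disjoint branches lead to neighbours of x (triangles sharing the edge xu).  *)
(* Hence putting x back raises the distance to a forest by at most a constant  *)
(* d. After deleting leaves and suppressing vertices of degree 2, the graph    *)
(* has a triangle or minimum degree 3; in the latter case Moore's bound gives  *)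
(* O(log n) vertices containing a cycle, and n is at most twice the distance   *)
(* to a forest. By induction on k, deleting these vertices leaves either k - 1 *)
(* disjoint cycles or a graph at distance at most g from a forest; in the      *)
(* second case n <= 2 (g + d O(log n)), so that n is bounded.                  *)

From mathcomp Require Import boolp.
Require Import Defs.
From mathcomp Require Import all_boot.
From mathcomp Require Import zify.

Set Implicit Arguments.
Unset Strict Implicit.
Unset Printing Implicit Defensive.

(** * Forests and connected sets in relations *)

(** Small edit distance or brittleness forces small capacity: edge-disjoint subgraphs that are not
    forests must each use a different deleted or crossing edge ([capacity_le_edit_distance],
    [capacity_le_edge_brittleness]). Bounded capacity excludes every fan family, because
    [Fan S (2 * k)] has [k] edge-disjoint cycles ([capacity_fan]).

    The return from excluded fans is an Erdos-Posa statement for the ideal,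
    [bounded_or_disjoint_cycles]: without large fans and books, either there are [k] disjoint cycles
    or a bounded number of edge deletions leaves a forest. It weighs two facts against each other.
    Putting back a vertex has bounded cost ([split_terminals], [forest_up_to_diff]), and with
    minimum degree 3 there is a cycle on logarithmically many vertices ([moore_bound]) although
    linearly many deletions are needed ([forest_up_to_card]). Few deletions bound the edit distance
    at once; for the brittleness the forest is cut further, so that every deleted edge joins two
    parts ([cut_forest]).

    A graph is mostly handled as a relation on a fixed type together with a vertex set [W], so that
    deleting or suppressing vertices does not change the type; [graph_on] turns such a pair into a
    graph when the ideal is invoked. *)

Definition restrict (T : finType) (e : rel T) (W : {set T}) : rel T :=
  fun x y => [&& e x y, x \in W & y \in W].

(** The empty set counts as connected; [low_branch] relies on this when the branch is the whole of
    [A]. *)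
Definition connected (T : finType) (e : rel T) (A : {set T}) : Prop :=
  {in A &, forall x y, connect (restrict e A) x y}.

Definition acyclic (T : finType) (e : rel T) : Prop :=
  forall c : seq T, ~ [/\ 2 < size c, uniq c & cycle e c].

Section Relations.
Variable T : finType.
Implicit Types (e f g : rel T) (A B W : {set T}) (x y z : T).

Lemma restrict_sym e A : symmetric e -> symmetric (restrict e A).
Proof. by move=> eS x y; rewrite /restrict eS [(x \in A) && _]andbC. Qed.

Lemma restrict_irr e A : irreflexive e -> irreflexive (restrict e A).
Proof. by move=> eI x; rewrite /restrict eI. Qed.

Lemma restrict_sub e A : subrel (restrict e A) e.
Proof. by move=> x y /and3P[]. Qed.

Lemma restrictS e f A B :
  subrel e f -> A \subset B -> subrel (restrict e A) (restrict f B).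
Proof.
move=> ef /subsetP AB x y /and3P[exy xA yA].
by rewrite /restrict ef // !AB.
Qed.

Lemma restrictI e A B : restrict (restrict e A) B =2 restrict e (A :&: B).
Proof. by move=> x y; rewrite /restrict !inE; case: (e x y); case: (x \in A); case: (y \in A) => //=; rewrite ?andbF. Qed.

Lemma connect_mono e f : subrel e f -> subrel (connect e) (connect f).
Proof. by move=> ef; apply: connect_sub => x y /ef; apply: connect1. Qed.

Lemma connect_restrictS e A B :
  A \subset B -> subrel (connect (restrict e A)) (connect (restrict e B)).
Proof. by move=> AB; apply/connect_mono/restrictS. Qed.

Lemma acyclic_sub e f : subrel e f -> acyclic f -> acyclic e.
Proof. by move=> ef fA c [c2 cU /(sub_cycle ef) cf]; apply: (fA c). Qed.

Lemma path_restrict e A x p :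
  x \in A -> path (restrict e A) x p = path e x p && all [in A] p.
Proof.
elim: p x => //= y p IH x xA; rewrite /restrict xA /=.
case: (boolP (y \in A)) => [/IH ->|]; last by rewrite !andbF.
by rewrite andbT andbA.
Qed.

Lemma connect_restrictP e A x y : x \in A ->
  reflect (exists p, [/\ path e x p, uniq (x :: p), all [in A] p & y = last x p])
          (connect (restrict e A) x y).
Proof.
move=> xA; apply: (iffP connectP) => [[p pe ->]|[p [pe _ pA ->]]].
  case/shortenP: pe => p' p'e p'U _; exists p'.
  by move: p'e; rewrite path_restrict // => /andP[].
by exists p; rewrite // path_restrict // pe.
Qed.

Lemma connect_restrict_mem e A x y :
  connect (restrict e A) x y -> x \in A -> y \in A.
Proof.
move=> + xA => /(connect_restrictP _ _ xA)[p [_ _ /allP pA ->]].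
by move: (mem_last x p); rewrite inE => /predU1P[->|/pA].
Qed.

(** On a path without repetitions, everything after the first step avoids [x]. *)
Lemma connect_step e x y : connect e x y -> x != y ->
  exists2 z, e x z & connect (restrict e [set~ x]) z y.
Proof.
move=> /connectP[p pe ->]; case/shortenP: pe => -[|z q] /=; rewrite ?eqxx //.
rewrite inE negb_or => /andP[exz qe] /andP[/andP[xz xq] _] _ _.
exists z => //; apply/connectP; exists q => //.
rewrite path_restrict ?inE 1?eq_sym // qe; apply/allP => w wq.
by rewrite !inE; apply: contraNneq xq => <-.
Qed.

(** A path from [y] to [z] avoiding [x] would close up through [x] into a cycle. Together with the
    converse [acyclicP], this turns acyclicity into a statement about reachability. *)
Lemma acyclic_nbrs e x y z : acyclic e -> symmetric e -> irreflexive e ->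
  e x y -> e x z -> connect (restrict e [set~ x]) y z -> y = z.
Proof.
move=> eA eS eI exy exz; have yx : y \in [set~ x].
  by rewrite !inE; apply: contraTneq exy => ->; rewrite eI.
case/(connect_restrictP _ _ yx) => -[|w p] [pe pU pA //= zE].
case: (eA (x :: y :: w :: p)); split=> //.
  rewrite cons_uniq pU andbT in_cons negb_or.
  apply/andP; split; first by move: yx; rewrite !inE eq_sym.
  by apply/negP => /(allP pA); rewrite !inE eqxx.
by rewrite (cycle_path x) /= -zE eS exz exy.
Qed.

Lemma acyclic_cycle_through e x c : 2 < size c -> uniq c -> cycle e c -> x \in c ->
  symmetric e ->
  exists y z p, [/\ e x y, e x z, y != z, z = last y p &
    [/\ path e y p, x \notin y :: p & uniq (y :: p)]].
Proof.
move=> + + + + eS => c2 cU cc /rot_to[i s cE].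
move: c2 cU cc; rewrite -(size_rot i c) -(rot_uniq i c) -(rot_cycle i e c) cE.
case: s {cE} => [|y [|w p]] // _ /= /and3P[xn yn pU].
rewrite rcons_path => /and4P[exy eyw wp ezx].
exists y, (last w p), (w :: p); split=> //=; first by rewrite eS.
- by apply: contraNneq yn => ->; rewrite mem_last.
- by split=> //; [rewrite eyw | rewrite yn].
Qed.

Lemma not_acyclic e : ~ acyclic e -> symmetric e -> irreflexive e ->
  exists x y z, [/\ e x y, e x z, y != z & connect (restrict e [set~ x]) y z].
Proof.
move=> /existsNP[c /contrapT[c2 cU cc]] eS eI.
case: c c2 cU cc => // x c c2 cU cc.
have [y [z [p [exy exz yz zE [pe xp pU]]]]] :=
  acyclic_cycle_through c2 cU cc (mem_head _ _) eS.
exists x, y, z; split=> //; apply/connectP; exists p => //.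
have xy : y \in [set~ x] by move: xp; rewrite !inE eq_sym; apply: contra => ->.
rewrite path_restrict // pe; apply/allP => w wp; rewrite !inE.
by apply: contraNneq xp => <-; rewrite inE wp orbT.
Qed.

Lemma acyclicP e : symmetric e -> irreflexive e ->
  (forall x y z, e x y -> e x z -> connect (restrict e [set~ x]) y z -> y = z) ->
  acyclic e.
Proof.
move=> eS eI H; apply: contrapT => /not_acyclic[] // x [y [z [exy exz yz c]]].
by move: yz; rewrite (H _ _ _ exy exz c) eqxx.
Qed.

Lemma path_avoid e f x y p :
  (forall z w, z != x -> w != x -> e z w -> f z w) -> x \notin y :: p ->
  path e y p -> path f y p.
Proof.
move=> ef xp; apply: (sub_in_path (P := predC1 x)) => [z w|]; first exact: ef.
by apply/allP => z zp; apply: contraNneq xp => <-.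
Qed.

Lemma cycle_avoid e f x c :
  (forall z w, z != x -> w != x -> e z w -> f z w) -> x \notin c ->
  cycle e c -> cycle f c.
Proof.
move=> ef xp; apply: (sub_in_cycle (P := predC1 x)) => [z w|]; first exact: ef.
by apply/allP => z zp; apply: contraNneq xp => <-.
Qed.

(** A cycle through [x] enters and leaves by two members of [K], which the rest of the cycle would
    connect in [e]. *)
Lemma acyclic_add_vertex e x (K : {set T}) :
  symmetric e -> irreflexive e -> acyclic e -> (forall y, ~~ e x y) -> x \notin K ->
  {in K &, forall y z, connect e y z -> y = z} ->
  acyclic [rel y z | [|| e y z, (y == x) && (z \in K) | (z == x) && (y \in K)]].
Proof.
move=> eS eI eA xN xK KU c [c2 cU cc].
set g := (X in cycle X _) in cc.
have gS : symmetric g by move=> y z; rewrite /g /= eS orbA orbAC -orbA.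
have gE y z : y != x -> z != x -> g y z -> e y z.
  by rewrite /g /= => /negPf-> /negPf->; rewrite !orbF.
have [xc|xc] := boolP (x \in c); last first.
  by apply: (eA c); split=> //; apply: cycle_avoid gE xc cc.
have [y [z [p [gxy gxz yz zE [pg xp pU]]]]] := acyclic_cycle_through c2 cU cc xc gS.
have xgK w : g x w -> w \in K.
  by rewrite /g /= (negPf (xN w)) eqxx (negPf xK) andbF orbF.
case/negP: yz; apply/eqP/KU; rewrite ?xgK //.
apply/connectP; exists p => //.
exact: path_avoid gE xp pg.
Qed.

(** Here [f] may have the path [a], [v], [b] in place of the edge [ab]. A cycle of [f] through [v]
    passes from [a] to [b], and its remainder would close with the edge [ab] into a cycle of [e]. *)
Lemma acyclic_subdivide e f a b v :
  symmetric e -> irreflexive e -> acyclic e -> (forall y, ~~ e v y) -> e a b ->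
  symmetric f ->
  (forall x y, x != v -> y != v -> f x y -> e x y && ([set x; y] != [set a; b])) ->
  (forall y, f v y -> y \in [set a; b]) ->
  acyclic f.
Proof.
move=> eS eI eA vN eab fS fE fv c [c2 cU cc].
have [vc|vc] := boolP (v \in c); last first.
  apply: (eA c); split=> //; apply: cycle_avoid vc cc => y z yv zv.
  by case/(fE _ _ yv zv)/andP.
have [y [z [p [gxy gxz yz zE [pg xp pU]]]]] := acyclic_cycle_through c2 cU cc vc fS.
pose h := [rel x y | e x y && ([set x; y] != [set a; b])].
have hc : connect h y z.
  by apply/connectP; exists p => //; apply: path_avoid fE xp pg.
have eyz : e y z && ([set y; z] == [set a; b]).
  move: (fv _ gxy) (fv _ gxz) yz; rewrite !inE.
  by move=> /orP[]/eqP-> /orP[]/eqP->; rewrite ?eqxx ?eab // setUC eqxx eS eab.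
case/andP: eyz => eyz /eqP yzE.
have [w /= /andP[eyw yw] cw] := connect_step hc yz.
move: yw; rewrite (@acyclic_nbrs e y w z) ?yzE ?eqxx //.
by apply: connect_mono cw; apply: restrictS => // u t /andP[].
Qed.

Lemma connected_cycle e A x y z :
  symmetric e -> irreflexive e -> connected e A -> x \notin A ->
  y \in A -> z \in A -> y != z -> e x y -> e x z -> ~ acyclic (restrict e (x |: A)).
Proof.
move=> eS eI cA xA yA zA yz exy exz gA; case/eqP: yz.
apply: (@acyclic_nbrs _ x _ _ gA).
- exact: restrict_sym.
- exact: restrict_irr.
- by rewrite /restrict exy !inE eqxx yA orbT.
- by rewrite /restrict exz !inE eqxx zA orbT.
apply: connect_mono (cA _ _ yA zA) => u w /and3P[euw uA wA].
rewrite /restrict euw !inE uA wA !orbT /=.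
by apply/andP; split; [apply: contraNneq xA => <- | apply: contraNneq xA => <-].
Qed.

Lemma connectedU1 e A x y :
  symmetric e -> connected e A -> y \in A -> e x y -> connected e (x |: A).
Proof.
move=> eS cA yA exy.
have AS : A \subset x |: A by apply: subsetUr.
have xc : {in A, forall z, connect (restrict e (x |: A)) x z}.
  move=> z zA; apply: (connect_trans (y := y)).
    by apply: connect1; rewrite /restrict exy !inE eqxx yA orbT.
  exact: connect_restrictS AS _ _ (cA _ _ yA zA).
move=> u w; rewrite !inE => /predU1P[->|uA] /predU1P[->|wA].
- exact: connect0.
- exact: xc.
- by rewrite (sym_connect_sym (restrict_sym _ eS)) xc.
- exact: connect_restrictS AS _ _ (cA _ _ uA wA).
Qed.

Lemma connectedU e A B x : symmetric e ->
  connected e A -> connected e B -> x \in A -> x \in B -> connected e (A :|: B).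
Proof.
move=> eS cA cB xA xB.
have H : {in A :|: B, forall z, connect (restrict e (A :|: B)) x z}.
  move=> z /setUP[zA|zB].
    exact: connect_restrictS (subsetUl A B) _ _ (cA _ _ xA zA).
  exact: connect_restrictS (subsetUr A B) _ _ (cB _ _ xB zB).
move=> u w uA wA; apply: (connect_trans _ (H _ wA)).
by rewrite (sym_connect_sym (restrict_sym _ eS)) H.
Qed.

Lemma card_pairs_vertex e v : symmetric e ->
  #|[set p | e p.1 p.2]| <=
  #|[set p | restrict e [set~ v] p.1 p.2]| + 2 * #|[set y | e v y]|.
Proof.
move=> eS; set N := [set y | e v y].
apply: (@leq_trans #|[set p | restrict e [set~ v] p.1 p.2] :|:
   ((fun y => (v, y)) @: N :|: (fun y => (y, v)) @: N)|).
  apply/subset_leq_card/subsetP => -[x y]; rewrite !inE /= => exy.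
  have [xv|xv] := eqVneq x v.
    by apply/orP; right; apply/orP; left; apply/imsetP; exists y; rewrite ?inE -xv.
  have [yv|yv] := eqVneq y v.
    by apply/orP; right; apply/orP; right; apply/imsetP; exists x; rewrite ?inE -yv 1?eS.
  by rewrite /restrict exy !inE xv yv.
rewrite (leq_trans (leq_card_setU _ _)) // leq_add2l mul2n -addnn.
by rewrite (leq_trans (leq_card_setU _ _)) // leq_add // leq_imset_card.
Qed.

End Relations.

(** * Recognizing topological minors *)

Lemma mem_edges (G : sgraph) (x y : G) : ([set x; y] \in edges G) = adj x y.
Proof.
apply/imsetP/idP => [[[z w]]|xy]; last by exists (x, y); rewrite ?inE.
rewrite inE /= => zw E.
have := set21 x y; have := set22 x y; rewrite E !inE.
case/orP=> /eqP yE /orP[]/eqP xE; subst => //; try by rewrite adj_sym.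
  by move: (set1_notin_edges z); rewrite E; case/negP; apply/imsetP; exists (z, w); rewrite ?inE.
by move: (set1_notin_edges w); rewrite E; case/negP; apply/imsetP; exists (z, w); rewrite ?inE.
Qed.

Lemma map_val_insub (T : Type) (A : pred T) (sT : subType A) (s : seq T) :
  all A s -> map val (pmap insub s : seq sT) = s.
Proof.
by move=> /all_filterP{2}<-; rewrite (pmap_filter (insubK sT)); apply: eq_filter => x;
  rewrite isSome_insub.
Qed.

Lemma infix2_mem (T : eqType) (u v : T) s : infix [:: u; v] s -> u \in s /\ v \in s.
Proof. by case/infixP => [s1 [s2 ->]]; rewrite !mem_cat !inE !eqxx !orbT. Qed.

Lemma infix_map (T S : eqType) (f : T -> S) s t :
  injective f -> infix (map f s) (map f t) = infix s t.
Proof.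
move=> fI; have prefix_map u w : prefix (map f u) (map f w) = prefix u w.
  by elim: u w => [|x u IH] [|y w] //=; rewrite IH inj_eq.
by elim: t => [|x t IH]; [case: s | rewrite map_cons !infix_consl -IH -prefix_map].
Qed.

Section Topological_minor.
Variables (H G : sgraph) (phi : H -> G) (P : H -> H -> seq G).
Let route x y := phi x :: rcons (P x y) (phi y).
Hypothesis phi_inj : injective phi.
Hypothesis P_rev : forall x y, adj x y -> P y x = rev (P x y).
Hypothesis P_path : forall x y, adj x y ->
  [/\ path (@adj G) (phi x) (rcons (P x y) (phi y)), uniq (route x y)
    & forall z, phi z \notin P x y].
Hypothesis P_disj : forall x y x' y', adj x y -> adj x' y' ->
  [set x; y] != [set x'; y'] -> forall w, w \in P x y -> w \notin P x' y'.

Let VS : {set G} := [set w | [exists x, w == phi x] || [exists x, exists y, adj x y && (w \in P x y)]].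
Let ES : {set {set G}} := [set [set p.1; p.2] | p : G * G &
  [exists x, exists y, adj x y && infix [:: p.1; p.2] (route x y)]].

Let phiVS x : phi x \in VS.
Proof. by rewrite inE; apply/orP; left; apply/existsP; exists x. Qed.

Let PVS x y : adj x y -> all [in VS] (P x y).
Proof.
move=> xy; apply/allP => w wP; rewrite inE; apply/orP; right.
by apply/existsP; exists x; apply/existsP; exists y; rewrite xy.
Qed.

Let routeVS x y : adj x y -> all [in VS] (route x y).
Proof. by move=> xy; rewrite /= all_rcons !phiVS PVS. Qed.

Let infix2_adj x y u v : adj x y -> infix [:: u; v] (route x y) -> adj u v.
Proof.
move=> xy /infixP[s [t rE]]; have [pe _ _] := P_path xy.
have : sorted (@adj G) (route x y) by [].
by rewrite rE; case: s {rE} => [|a s] /=; [case/andP | rewrite cat_path /= => /and4P[]].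
Qed.

Let infix2_rev x y u v : adj x y -> infix [:: u; v] (route x y) -> infix [:: v; u] (route y x).
Proof.
move=> xy uv; have -> : route y x = rev (route x y).
  by rewrite /route P_rev // rev_cons rev_rcons.
by rewrite -[[:: v; u]]/(rev [:: u; v]) infix_rev.
Qed.

Let ES_edges : ES \subset edges G.
Proof.
apply/subsetP => _ /imsetP[[u v]] + ->; rewrite inE => /existsP[x /existsP[y /andP[xy i]]].
by rewrite mem_edges; exact: infix2_adj xy i.
Qed.

Let ES_vert : cover ES \subset VS.
Proof.
apply/bigcupsP => _ /imsetP[[u v]] + ->; rewrite inE => /existsP[x /existsP[y /andP[xy i]]].
have [ur vr] := infix2_mem i.
by apply/subsetP => w /set2P[]->; apply: (allP (routeVS xy)).
Qed.

Let G' : subgraph G := Subgraph ES_edges ES_vert.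

Let infix_ES x y u v : adj x y -> infix [:: u; v] (route x y) -> [set u; v] \in ES.
Proof.
move=> xy i; apply/imsetP; exists (u, v); rewrite ?inE //.
by apply/existsP; exists x; apply/existsP; exists y; rewrite xy.
Qed.

Let phi' (x : H) : sub_graph G' := exist _ (phi x) (phiVS x).
Let P' (x y : H) : seq (sub_graph G') := pmap insub (P x y).

Let P'E x y : adj x y -> map val (P' x y) = P x y.
Proof. by move=> xy; rewrite map_val_insub // PVS. Qed.

Let routeE x y : adj x y -> map val (phi' x :: rcons (P' x y) (phi' y)) = route x y.
Proof. by move=> xy; rewrite /= map_rcons P'E. Qed.

Let path_infix (e : rel G) z (p : seq G) :
  (forall u v, infix [:: u; v] (z :: p) -> e u v) -> path e z p.
Proof.
elim: p z => //= w p IH z He; apply/andP; split; first exact/He/(prefix_infix [:: z; w]).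
by apply: IH => u v uv; apply: He; apply/orP; right.
Qed.

(** The routes span a subgraph that serves as its own subdivision, with the identity as isomorphism;
    the clauses forbidding further vertices and edges then hold by construction. *)
Lemma topological_minorI : topological_minor H G.
Proof.
exists (sub_graph G'), G'; split; last by exists id => //; exists id.
exists phi', P'; split.
- by move=> x y [/phi_inj].
- move=> x y xy; apply: (inj_map val_inj); have yx : adj y x by rewrite adj_sym.
  by rewrite map_rev !P'E // P_rev.
- move=> x y xy; have [pe rU rN] := P_path xy; split.
  + rewrite -[path _ _ _]/(path (relpre val (fun u v => [set u; v] \in ES)) _ _).
    rewrite -path_map map_rcons P'E //=.
    by apply: path_infix => u v; apply: infix_ES.
  + by move: rU; rewrite -(routeE xy) (map_inj_uniq val_inj).
  + by move=> z; rewrite mem_pmap_sub; apply: rN.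
- by move=> x y x' y' xy x'y' N w; rewrite !mem_pmap_sub; apply: P_disj.
have infixE x y u v : adj x y ->
    infix [:: u; v] (phi' x :: rcons (P' x y) (phi' y)) = infix [:: val u; val v] (route x y).
  by move=> xy; rewrite -(infix_map _ _ val_inj) routeE.
split=> [w|u v].
  have := valP w; rewrite inE => /orP[/existsP[x /eqP wE]|/existsP[x /existsP[y /andP[xy wP]]]].
    by left; exists x; apply: val_inj.
  by right; exists x, y; split=> //; rewrite mem_pmap_sub.
case/imsetP=> -[u' v']; rewrite inE => /existsP[x /existsP[y /andP[xy i]]] /= E.
have u'v' := infix2_adj xy i; have := set21 (val u) (val v); have := set22 (val u) (val v).
have uv : val u != val v.
  apply: contraTneq u'v' => uv; rewrite -mem_edges -E uv; exact: set1_notin_edges.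
(* The unordered edge may be traversed in the opposite direction, in which case the route from [y]
   to [x] is taken. *)
rewrite E !inE => /orP[]/eqP vE /orP[]/eqP uE; rewrite uE vE ?eqxx // in uv.
  exists y, x; have yx : adj y x by rewrite adj_sym.
  by split=> //; apply: etrans (infixE _ _ u v yx) _; rewrite uE vE infix2_rev.
by exists x, y; split=> //; apply: etrans (infixE _ _ u v xy) _; rewrite uE vE.
Qed.

End Topological_minor.

(** * Topological minors inside a relation restricted to a vertex set *)

Section Graph_on.
Variables (T : finType) (e : rel T) (W : {set T}).

Let graph_on_adj : rel {x : T | x \in W} :=
  fun x y => (val x != val y) && (e (val x) (val y) || e (val y) (val x)).

Let graph_on_sym : symmetric graph_on_adj.
Proof. by move=> x y; rewrite /graph_on_adj eq_sym orbC. Qed.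

Let graph_on_irr : irreflexive graph_on_adj.
Proof. by move=> x; rewrite /graph_on_adj eqxx. Qed.

(* The symmetric irreflexive closure makes this a graph for every relation.    *)
Definition graph_on : sgraph := SGraph graph_on_sym graph_on_irr.

Hypotheses (eS : symmetric e) (eI : irreflexive e).

Lemma graph_onE (x y : graph_on) : adj x y = e (val x) (val y).
Proof.
rewrite /= /graph_on_adj [e (val y) _]eS orbb.
by case: eqVneq => //= ->; rewrite eI.
Qed.

Lemma topological_minor_graph_on (H : sgraph) (phi : H -> T) (P : H -> H -> seq T) :
  injective phi -> (forall x, phi x \in W) ->
  (forall x y, adj x y -> [/\ P y x = rev (P x y), all [in W] (P x y),
     path e (phi x) (rcons (P x y) (phi y)), uniq (P x y)
     & forall z, phi z \notin P x y]) ->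
  (forall x y x' y', adj x y -> adj x' y' -> [set x; y] != [set x'; y'] ->
     forall w, w \in P x y -> w \notin P x' y') ->
  topological_minor H graph_on.
Proof.
move=> phi_inj phiW HP Pdisj.
pose phi' (x : H) : graph_on := exist _ (phi x) (phiW x).
pose P' (x y : H) : seq graph_on := pmap insub (P x y).
have P'E x y : adj x y -> map val (P' x y) = P x y.
  by move=> /HP[_ PW _ _ _]; rewrite map_val_insub.
apply: (@topological_minorI H graph_on phi' P') => [x y [/phi_inj]//|x y xy|x y xy|].
- have yx : adj y x by rewrite adj_sym.
  by apply: (inj_map val_inj); rewrite map_rev !P'E //; case: (HP _ _ xy).
- have [_ _ pe PU PN] := HP _ _ xy; split.
  + rewrite (eq_path (e' := relpre val e)); last exact: graph_onE.
    by rewrite -path_map map_rcons P'E.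
  + rewrite -(map_inj_uniq val_inj) /= map_rcons P'E //= rcons_uniq PU PN mem_rcons inE.
    rewrite negb_or PN !andbT /=; apply: contraTneq xy => /phi_inj->.
    by rewrite adj_irr.
  + by move=> z; rewrite mem_pmap_sub; apply: PN.
- by move=> x y x' y' xy x'y' N w; rewrite !mem_pmap_sub; apply: Pdisj N _.
Qed.

End Graph_on.

Section Minors.
Variables (T : finType) (e : rel T).
Hypotheses (eS : symmetric e) (eI : irreflexive e).

Lemma topological_minor_graph_onS (W W' : {set T}) :
  W' \subset W -> topological_minor (graph_on e W') (graph_on e W).
Proof.
move=> /subsetP WW'; apply: (@topological_minor_graph_on _ _ _ eS eI (graph_on e W') val (fun _ _ => [::])).
- exact: val_inj.
- by move=> x; apply/WW'/valP.
- by move=> x y; rewrite graph_onE //= andbT.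
- by [].
Qed.

Definition add_edge (a b : T) : rel T :=
  fun x y => e x y || ((a != b) && ([set x; y] == [set a; b])).

Lemma add_edge_sym a b : symmetric (add_edge a b).
Proof. by move=> x y; rewrite /add_edge eS setUC. Qed.

Lemma add_edge_irr a b : irreflexive (add_edge a b).
Proof.
move=> x; rewrite /add_edge eI setUid; case: eqVneq => //= ab.
apply/negP => /eqP E; have := set21 a b; have := set22 a b; rewrite -E !inE.
by move=> /eqP bx /eqP ax; rewrite ax bx eqxx in ab.
Qed.

Lemma set2_inj (a b x y : T) : [set x; y] = [set a; b] ->
  (x = a /\ y = b) \/ (x = b /\ y = a).
Proof.
move=> E; have := set21 x y; have := set22 x y; rewrite E !inE.
have := set21 a b; have := set22 a b; rewrite -E !inE.
by do 4![case/orP=> /eqP ?]; subst; auto.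
Qed.

(** The new edge stands for the path through [q], whose inner vertices are removed so as to be free
    for it. With [q] a single vertex of degree two this is its suppression. *)
Lemma topological_minor_add_edge (W : {set T}) a b q :
  a \in W -> b \in W -> all [in W] q -> uniq (a :: rcons q b) ->
  path e a (rcons q b) ->
  topological_minor (graph_on (add_edge a b) (W :\: [set x in q])) (graph_on e W).
Proof.
move=> aW bW qW; rewrite /= rcons_uniq mem_rcons inE negb_or.
move=> /andP[/andP[ab aq] /andP[bq qU]] pe.
pose H := graph_on (add_edge a b) (W :\: [set x in q]).
have HE (x y : H) : adj x y = add_edge a b (val x) (val y).
  by apply: graph_onE; [apply: add_edge_sym | apply: add_edge_irr].
pose P (x y : H) := if e (val x) (val y) then [::] else
  if val x == a then q else rev q.
have PE (x y : H) : adj x y -> ~~ e (val x) (val y) ->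
    (val x = a /\ val y = b /\ P x y = q) \/ (val x = b /\ val y = a /\ P x y = rev q).
  rewrite HE /add_edge /P => /orP[->//|/andP[_ /eqP/set2_inj xy]] /negPf->.
  case: xy => [[-> ->]|[-> ->]]; rewrite ?eqxx; [by left | right].
  by rewrite eq_sym (negPf ab).
apply: (@topological_minor_graph_on _ _ _ eS eI H val P).
- exact: val_inj.
- by move=> x; have := valP x; rewrite inE => /andP[].
- move=> x y xy; have yx : adj y x by rewrite adj_sym.
  have [exy|exy] := boolP (e (val x) (val y)).
    by rewrite /P eS exy /= exy.
  have eyx : ~~ e (val y) (val x) by rewrite eS.
  have NP (z : H) : val z \notin q by have := valP z; rewrite !inE => /andP[].
  have [[xE [yE ->]]|[xE [yE ->]]] := PE _ _ xy exy.
    have [[yE' _]|[_ [_ ->]]] := PE _ _ yx eyx; first by rewrite -yE yE' eqxx in ab.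
    by split=> //; rewrite xE yE.
  have [[_ [_ ->]]|[yE' _]] := PE _ _ yx eyx; last by rewrite -yE yE' eqxx in ab.
  rewrite revK all_rev rev_uniq; split=> //; last by move=> z; rewrite mem_rev.
  rewrite xE yE -rev_cons; move: pe; rewrite -(eq_path (e := fun x y => e y x)); last first.
    by move=> u v; apply: eS.
  by rewrite -rev_path last_rcons belast_rcons.
- move=> x y x' y' xy x'y' N w wP.
  have [exy|exy] := boolP (e (val x) (val y)); first by rewrite /P exy in wP.
  have [exy'|exy'] := boolP (e (val x') (val y')); first by rewrite /P exy'.
  have inj (u v : H) c : val u = c -> val v = c -> u = v.
    by move=> uc vc; apply: val_inj; rewrite uc vc.
  case/eqP: N.
  have [[xE [yE _]]|[xE [yE _]]] := PE _ _ xy exy;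
  have [[xE' [yE' _]]|[xE' [yE' _]]] := PE _ _ x'y' exy'.
  - by rewrite (inj _ _ _ xE xE') (inj _ _ _ yE yE').
  - by rewrite (inj _ _ _ xE yE') (inj _ _ _ yE xE') setUC.
  - by rewrite (inj _ _ _ xE yE') (inj _ _ _ yE xE') setUC.
  - by rewrite (inj _ _ _ xE xE') (inj _ _ _ yE yE').
Qed.

End Minors.

(** * Almost-forests *)

(* Deleted edges are counted as ordered pairs, so twice.                       *)
Definition forest_up_to (T : finType) (e : rel T) (W : {set T}) (l : nat) : Prop :=
  exists f : rel T, [/\ symmetric f, subrel f (restrict e W), acyclic f
    & #|[set p | restrict e W p.1 p.2 && ~~ f p.1 p.2]| <= l].

Definition nbrs (T : finType) (e : rel T) (W : {set T}) x : {set T} := [set y in W | e x y].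

Section Forest_up_to.
Variables (T : finType) (e : rel T).
Hypotheses (eS : symmetric e) (eI : irreflexive e).
Implicit Types (W K : {set T}) (x y : T).

Lemma forest_up_to_leq W l m : l <= m -> forest_up_to e W l -> forest_up_to e W m.
Proof. by move=> lm [f [fS fW fA fl]]; exists f; split=> //; apply: leq_trans lm. Qed.

Lemma nbrs_sub W x : nbrs e W x \subset W.
Proof. by apply/subsetP => y; rewrite inE => /andP[]. Qed.

(** The vertex [x] is hung on the forest by its edges to [K], at most one per component, so no cycle
    arises; its other edges are deleted, each counting as two ordered pairs. *)
Lemma forest_up_to_vertex W x K l :
  x \in W -> K \subset nbrs e (W :\ x) x ->
  {in K &, forall y z, connect (restrict e (W :\ x)) y z -> y = z} ->
  forest_up_to e (W :\ x) l -> forest_up_to e W (l + 2 * #|nbrs e (W :\ x) x :\: K|).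
Proof.
move=> xW /subsetP KN KU [f [fS fW fA fl]].
have KE y : y \in K -> [/\ y != x, y \in W & e x y].
  by move=> /KN; rewrite !inE -andbA => /and3P[].
have xK : x \notin K by apply/negP => /KE[]; rewrite eqxx.
have fI : irreflexive f by move=> y; apply/negP => /fW/and3P[]; rewrite eI.
have fx y : ~~ f x y by apply/negP => /fW/and3P[_]; rewrite !inE eqxx.
pose g := [rel y z | [|| f y z, (y == x) && (z \in K) | (z == x) && (y \in K)]].
have gS : symmetric g by move=> y z; rewrite /g /= fS; congr orb; rewrite orbC.
exists g; split=> // [y z /or3P[/fW|/andP[/eqP-> /KE[_ zW exz]]|/andP[/eqP-> /KE[_ yW exy]]]||].
- by apply: restrictS => //; apply: subsetDl.
- by rewrite /restrict exz xW.
- by rewrite /restrict eS exy xW yW.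
- apply: acyclic_add_vertex => // y z yK zK yz; apply: KU => //.
  exact: connect_mono yz.
pose h : rel T := fun y z => restrict e W y z && ~~ g y z.
have hS : symmetric h by move=> y z; congr (_ && ~~ _); [apply: restrict_sym | apply: gS].
apply: leq_trans (card_pairs_vertex x hS) _; apply: leq_add.
  apply: leq_trans fl; apply/subset_leq_card/subsetP => -[y z]; rewrite !inE /=.
  case/and3P=> /andP[/and3P[eyz yW zW] gyz]; rewrite !inE => yx zx.
  by rewrite /restrict eyz !inE yx zx yW zW; apply: contra gyz => /= ->.
rewrite leq_mul2l /=; apply/subset_leq_card/subsetP => y; rewrite !inE /h /=.
case/andP=> /and3P[exy _ yW]; rewrite !negb_or eqxx /= => /and3P[_ -> _].
by rewrite exy yW !andbT; apply: contraTneq exy => ->; rewrite eI.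
Qed.

Lemma forest_up_to_leaf W x l : x \in W -> #|nbrs e W x| <= 1 ->
  forest_up_to e (W :\ x) l -> forest_up_to e W l.
Proof.
move=> xW N1 /(@forest_up_to_vertex W x (nbrs e (W :\ x) x)).
rewrite setDv cards0 muln0 addn0; apply=> // y z.
rewrite !inE -!andbA => /and3P[_ yW exy] /and3P[_ zW exz] _.
by apply: (card_le1_eqP N1); rewrite inE ?yW ?zW.
Qed.

(** If the forest uses the new edge [ab], that edge is subdivided by [v]. Otherwise [v] becomes a
    leaf at [a], and deleting [vb] is paid for by the deletion of [ab]. *)
Lemma forest_up_to_suppress W v a b l : v \in W -> nbrs e W v = [set a; b] ->
  a != b -> ~~ e a b ->
  forest_up_to (add_edge e a b) (W :\ v) l -> forest_up_to e W l.
Proof.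
move=> vW Nv ab Neab [f [fS fW fA fl]].
have [/andP[aW eva] /andP[bW evb]] : (a \in W) && e v a /\ (b \in W) && e v b.
  have := set21 a b; have := set22 a b; rewrite -Nv !inE.
  by [].
have av : a != v by apply: contraTneq eva => ->; rewrite eI.
have bv : b != v by apply: contraTneq evb => ->; rewrite eI.
have fI : irreflexive f.
  by move=> y; apply/negP => /fW/and3P[]; rewrite add_edge_irr.
have fv y : ~~ f v y by apply/negP => /fW/and3P[_]; rewrite !inE eqxx.
have fE y z : f y z -> [set y; z] != [set a; b] -> restrict e (W :\ v) y z.
  move=> /fW/and3P[]; rewrite /add_edge => /orP[eyz yW zW _|/andP[_ ->//]].
  by rewrite /restrict eyz yW.
have eab y z : e y z -> [set y; z] != [set a; b].
  by move=> eyz; apply: contraNneq Neab => /set2_inj[[<- <-]|[<- <-]] //; rewrite eS.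
have abN w : e v w -> w \in W -> w \in [set a; b] by move=> evw wW; rewrite -Nv inE wW.
have [fab|Nfab] := boolP (f a b).
  pose g : rel T := fun y z => (f y z && ([set y; z] != [set a; b])) ||
    ((y == v) && (z \in [set a; b])) || ((z == v) && (y \in [set a; b])).
  have gS : symmetric g by move=> y z; rewrite /g fS [[set y; _]]setUC orbAC.
  exists g; split=> //.
  - move=> y z /orP[/orP[/andP[fyz /(fE _ _ fyz)]|]|].
    + by apply: restrictS => //; apply: subsetDl.
    + case/andP => /eqP-> /set2P[]->; rewrite /restrict ?vW ?aW ?bW ?eva ?evb //.
    + case/andP => /eqP-> /set2P[]->; rewrite /restrict eS ?vW ?aW ?bW ?eva ?evb //.
  - apply: (@acyclic_subdivide _ f g a b v) => // [y z yv zv|y].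
      by rewrite /g (negPf yv) (negPf zv) !orbF.
    rewrite /g (negPf (fv y)) eqxx /= => /orP[//|/andP[/eqP->]].
    by rewrite !inE ![v == _]eq_sym (negPf av) (negPf bv).
  apply: leq_trans fl; apply/subset_leq_card/subsetP => -[y z].
  rewrite !inE /= => /andP[/and3P[eyz yW zW] Ng].
  have yv : y != v.
    by apply: contraNneq Ng => yv; rewrite /g yv eqxx abN -?yv // orbT.
  have zv : z != v.
    apply: contraNneq Ng => zv; have yab : y \in [set a; b] by apply: abN; rewrite // -zv eS.
    by rewrite /g zv eqxx yab !orbT.
  rewrite /restrict /add_edge eyz !inE yv zv yW zW /=.
  by apply: contra Ng => fyz; rewrite /g fyz eab.
have fab y z : f y z -> [set y; z] != [set a; b].
  by move=> fyz; apply: contraNneq Nfab => /set2_inj[[<- <-]|[<- <-]] //; rewrite fS.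
pose g := [rel y z | [|| f y z, (y == v) && (z \in [set a]) | (z == v) && (y \in [set a])]].
exists g; split=> //.
- by move=> y z; rewrite /g /= fS; congr orb; rewrite orbC.
- move=> y z /or3P[fyz|/andP[/eqP-> /set1P->]|/andP[/eqP-> /set1P->]].
  + by apply: restrictS (fE _ _ fyz (fab _ _ fyz)) => //; apply: subsetDl.
  + by rewrite /restrict eva vW aW.
  + by rewrite /restrict eS eva vW aW.
- apply: acyclic_add_vertex => //; first by rewrite inE eq_sym.
  by move=> y z /set1P-> /set1P->.
set R := [set p | _] in fl.
have abR : (a, b) \in R /\ (b, a) \in R.
  have rab : restrict (add_edge e a b) (W :\ v) a b.
    by rewrite /restrict /add_edge ab eqxx orbT !inE av bv aW.
  have rba := rab; rewrite restrict_sym in rba; last exact: add_edge_sym.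
  by split; rewrite inE /= ?rab ?rba ?[f b a]fS Nfab.
(* The pairs [(a, b)] and [(b, a)] drop out because [a] and [b] are not adjacent in [e]; [(v, b)]
   and [(b, v)] take their place, so the count does not grow. *)
apply: (@leq_trans #|(R :\ (a, b) :\ (b, a)) :|: [set (v, b); (b, v)]|).
  apply/subset_leq_card/subsetP => -[y z].
  rewrite !inE /= => /andP[/and3P[eyz yW zW]]; rewrite !negb_or => /and3P[Nf].
  have [yv|yv] := eqVneq y v.
    have /set2P[->|->] : z \in [set a; b] by apply: abN => //; rewrite -yv.
      by rewrite set11.
    by rewrite yv !eqxx !orbT.
  have [zv|zv] := eqVneq z v.
    have /set2P[->|->] : y \in [set a; b] by apply: abN => //; rewrite -zv eS.
      by rewrite set11.
    by rewrite zv !eqxx !orbT.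
  have := eab _ _ eyz => N _ _; rewrite !xpair_eqE /restrict /add_edge eyz !inE yv zv yW zW Nf /= andbT.
  apply/orP; left; apply/andP; split; apply: contraNN N => /andP[/eqP-> /eqP->] //.
  by rewrite setUC.
rewrite (leq_trans (leq_card_setU _ _)) // cards2.
have ba : (b, a) != (a, b) by rewrite xpair_eqE eq_sym (negPf ab).
have bav : (v, b) != (b, v) by rewrite xpair_eqE eq_sym (negPf bv).
have := cardsD1 (a, b) R; rewrite abR.1.
have := cardsD1 (b, a) (R :\ (a, b)); rewrite in_setD1 ba abR.2 bav /=.
by move=> E2 E1; rewrite E1 E2 in fl; rewrite addn2.
Qed.

End Forest_up_to.

(** * Counting the edges of forests *)

Section Forest_size.
Variable T : finType.
Implicit Types (e f : rel T) (W : {set T}).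

(** Without a leaf a path could be prolonged forever: its end has a neighbour other than the
    preceding vertex, and acyclicity keeps that neighbour off the path. *)
Lemma acyclic_leaf f W : symmetric f -> irreflexive f -> acyclic f ->
  W != set0 -> exists2 x, x \in W & #|nbrs f W x| <= 1.
Proof.
move=> fS fI fA /set0Pn[x0 x0W]; apply: contrapT => /forall2NP leafless.
have deg x : x \in W -> 1 < #|nbrs f W x|.
  by move=> xW; have [//|/negP] := leafless x; rewrite -ltnNge.
have long n : exists x p, [/\ size p = n, path f x p, uniq (x :: p) & x \in W].
  elim: n => [|n [x [p [pn fp pU xW]]]]; first by exists x0, [::].
  have [y [yW xy yp]] : exists y, [/\ y \in W, f x y & y != head x p].
    have /card_gt1P[a [b]] := deg x xW; rewrite !inE => -[/andP[aW xa] /andP[bW xb] ab].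
    have [aE|Na] := eqVneq a (head x p); last by exists a.
    by exists b; split; rewrite // -aE eq_sym.
  exists y, (x :: p); split=> //=; rewrite ?pn // ?[f y x]fS ?xy //.
  rewrite -cons_uniq cons_uniq pU andbT; apply/negP; rewrite inE => /predU1P[yx|yIp].
    by rewrite yx fI in xy.
  case: p {pn} fp pU yp yIp => // z p /= /andP[xz zp] /andP[xp zU] yz yIp.
  case/eqP: yz; apply: esym; apply: (@acyclic_nbrs _ f x z y) => //.
  have xz' : z \in [set~ x] by move: xp; rewrite !inE eq_sym; apply: contra => ->.
  apply: (path_connect (p := p)) yIp; rewrite path_restrict // zp.
  by apply/allP => w wp; rewrite !inE; apply: contraNneq xp => <-; rewrite inE wp orbT.
have [x [p [pn _ pU _]]] := long #|T|.
by have := max_card (mem (x :: p)); rewrite (card_uniqP pU) /= pn ltnn.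
Qed.

(** Leaves are removed one at a time, each carrying at most one edge, that is, two ordered pairs. *)
Lemma acyclic_card f W : symmetric f -> irreflexive f -> acyclic f ->
  subrel f (restrict f W) -> #|[set p | f p.1 p.2]| <= 2 * #|W|.
Proof.
have [n] := ubnP #|W|; elim: n W f => // n IH W f Wn fS fI fA fW.
have [W0|W0] := eqVneq W set0.
  rewrite (_ : [set p | _] = set0) ?cards0 //; apply/setP => -[x y]; rewrite !inE /=.
  by apply/negP => /fW/and3P[_]; rewrite W0 inE.
have [x xW x1] := acyclic_leaf fS fI fA W0.
apply: leq_trans (card_pairs_vertex x fS) _.
have := cardsD1 x W; rewrite xW => WE.
have N1 : #|[set y | f x y]| <= 1.
  apply: leq_trans x1; apply/subset_leq_card/subsetP => y; rewrite !inE => fxy.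
  by rewrite fxy andbT; case/and3P: (fW _ _ fxy).
have IHx : #|[set p | restrict f [set~ x] p.1 p.2]| <= 2 * #|W :\ x|.
  apply: IH; first by rewrite -ltnS; apply: leq_trans Wn; rewrite WE.
  - exact: restrict_sym.
  - exact: restrict_irr.
  - exact: acyclic_sub (@restrict_sub _ _ _) fA.
  - move=> y z /and3P[fyz]; have /and3P[_ yW zW] := fW _ _ fyz; rewrite !inE => yx zx.
    by rewrite /restrict fyz !inE yx zx yW.
by apply: leq_trans (leq_add IHx (leq_mul (leqnn 2) N1)) _; rewrite WE mulnDr addnC.
Qed.

(** Minimum degree 3 gives at least [3 * #|W|] ordered pairs, of which a forest keeps at most
    [2 * #|W|]. *)
Lemma forest_up_to_card e W l : irreflexive e -> {in W, forall x, 3 <= #|nbrs e W x|} ->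
  forest_up_to e W l -> #|W| <= l.
Proof.
move=> eI deg3 [f [fS fW fA fl]].
have fI : irreflexive f by move=> x; apply/negP => /fW/and3P[]; rewrite eI.
have fcard : #|[set p | f p.1 p.2]| <= 2 * #|W|.
  by apply: acyclic_card => // x y fxy; have /and3P[_ xW yW] := fW _ _ fxy; rewrite /restrict fxy xW.
have ecard : 3 * #|W| <= #|[set p | restrict e W p.1 p.2]|.
  rewrite -sum1dep_card -(pair_big_dep xpredT (restrict e W) (fun _ _ => 1)) (bigID (mem W)) /=.
  apply: leq_trans (leq_addr _ _); rewrite mulnC -sum_nat_const; apply: leq_sum => x xW.
  rewrite sum1dep_card; apply: leq_trans (deg3 _ xW) _; apply/subset_leq_card/subsetP => y.
  by rewrite !inE /restrict xW => /andP[-> ->].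
have := cardsID [set p | f p.1 p.2] [set p | restrict e W p.1 p.2].
set A := _ :&: _; set B := _ :\: _ => AB.
have A2 : #|A| <= 2 * #|W| by apply: leq_trans fcard; apply/subset_leq_card/subsetIr.
have Bl : #|B| <= l.
  by apply: leq_trans fl; apply/subset_leq_card/subsetP => p; rewrite !inE andbC.
rewrite -(leq_add2l (2 * #|W|)) addnC -mulSn; apply: leq_trans ecard _.
by rewrite -AB leq_add.
Qed.


End Forest_size.

(** * Splitting off branches of a tree *)

Definition component (T : finType) (e : rel T) (W : {set T}) x : {set T} :=
  [set y | connect (restrict e W) x y].

Definition disjoint_family (T : finType) (P : {set {set T}}) : Prop :=
  {in P &, forall A B : {set T}, A != B -> [disjoint A & B]}.

(** A path in [A] between two neighbours of [x] closes through [x], so this yields a subdivision of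
    [Fan [set o0] k] with centre [x]. *)
Definition has_fan (T : finType) (e : rel T) (W : {set T}) k : Prop :=
  exists2 x, x \in W & exists P : {set {set T}}, [/\ k <= #|P|, disjoint_family P &
    {in P, forall A : {set T}, [/\ A \subset W :\ x, connected e A & 1 < #|A :&: [set y | e x y]|]}].

(** Each page [A] carries a path from [u] to [x]; the spine [x], [u] need not be an edge. *)
Definition has_book (T : finType) (e : rel T) (W : {set T}) k : Prop :=
  exists x u, [/\ x \in W, u \in W, x != u & exists P : {set {set T}},
    [/\ k <= #|P|, disjoint_family P &
      {in P, forall A : {set T}, [/\ A \subset W :\ x :\ u, connected e A,
        exists2 y, y \in A & e u y & exists2 y, y \in A & e x y]}]].

Section Components.
Variables (T : finType) (e : rel T).
Hypothesis eS : symmetric e.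
Implicit Types (W A D N : {set T}) (x y u : T).

Let cS W : symmetric (connect (restrict e W)).
Proof. exact: sym_connect_sym (restrict_sym W eS). Qed.

Lemma component_sub W x : x \in W -> component e W x \subset W.
Proof. by move=> xW; apply/subsetP => y; rewrite inE => /connect_restrict_mem; apply. Qed.

Lemma mem_component W x : x \in component e W x.
Proof. by rewrite inE connect0. Qed.

Lemma component_eq W x y : y \in component e W x -> component e W y = component e W x.
Proof.
rewrite inE => xy; apply/setP => z; rewrite !inE.
by rewrite (same_connect (cS W) xy).
Qed.

Lemma component_disjoint W x y : component e W x != component e W y ->
  [disjoint component e W x & component e W y].
Proof.
move=> N; rewrite disjoint_subset; apply/subsetP => z zx; rewrite inE.
by apply: contraNN N => zy; rewrite -(component_eq zx) -(component_eq zy).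
Qed.

Lemma connect_closed W (C : {set T}) x y : (forall u w, u \in C -> restrict e W u w -> w \in C) ->
  x \in C -> connect (restrict e W) x y -> connect (restrict e C) x y.
Proof.
move=> Ccl xC /connectP[p pe ->]; elim: p x xC pe => [|w p IH] x xC /=.
  by rewrite connect0.
case/andP => xw /(IH _ (Ccl _ _ xC xw)); apply: connect_trans; apply: connect1.
by rewrite /restrict xC (Ccl _ _ xC xw); case/and3P: xw => ->.
Qed.

Lemma component_connected W x : connected e (component e W x).
Proof.
move=> y z yx zx; have xC := mem_component W x.
apply: (@connect_closed W) => // [u w|]; rewrite ?inE.
  by move=> xu uw; apply: connect_trans xu (connect1 uw).
by move: yx zx; rewrite !inE cS => yx; apply: connect_trans.
Qed.

Lemma connectedI A u : u \in A -> {in A, forall x, connect (restrict e A) u x} ->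
  connected e A.
Proof. by move=> uA H x y xA yA; apply: connect_trans (H _ yA); rewrite cS H. Qed.

Lemma component_attached D u b : connected e D -> u \in D -> b \in D :\ u ->
  exists2 w, w \in component e (D :\ u) b & e u w.
Proof.
move=> cD uD; rewrite !inE => /andP[bu bD].
have := cD _ _ uD bD; rewrite eq_sym in bu.
move=> /connect_step -/(_ bu)[w uw wb]; exists w; last by case/and3P: uw.
rewrite inE cS; apply: connect_mono wb => x y; rewrite restrictI.
by apply: restrictS => //; apply/subsetP => z; rewrite !inE andbC.
Qed.

(** Every other component of [D :\ u] is still attached to [u]. *)
Lemma connected_diff_component D u b : connected e D -> u \in D -> b \in D :\ u ->
  connected e (D :\: component e (D :\ u) b).
Proof.
set B := component _ _ _ => cD uD bD; have BD := component_sub bD.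
have uB : u \notin B by apply/negP => /(subsetP BD); rewrite !inE eqxx.
apply: (@connectedI _ u) => [|x]; first by rewrite in_setD uB.
rewrite in_setD => /andP[xB xD]; have [->|xu] := eqVneq x u; first exact: connect0.
have xDu : x \in D :\ u by rewrite !inE xu.
have [w xw uw] := component_attached cD uD xDu.
have CB : component e (D :\ u) x \subset D :\: B.
  rewrite subsetD (subset_trans (component_sub xDu) (subsetDl _ _)) /=.
  apply: component_disjoint; apply: contraNneq xB => xbE.
  by rewrite /B -xbE mem_component.
apply: (@connect_trans _ _ w).
  apply: connect1; rewrite /restrict uw (subsetP CB w xw) in_setD uB uD //.
apply: connect_restrictS CB _ _ _; apply: component_connected => //.
exact: mem_component.
Qed.

(* D is a lowest branch of A carrying two terminals; u is its root. *)
Lemma low_branch A N : connected e A -> 1 < #|A :&: N| ->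
  exists D u, [/\ D \subset A, connected e D, connected e (A :\: D), 1 < #|D :&: N| &
    u \in D /\ {in D :\ u, forall b, #|component e (D :\ u) b :&: N| <= 1}].
Proof.
move=> cA A2.
have [u uA] : exists u, u \in A.
  by apply/set0Pn; apply: contraTneq A2 => ->; rewrite set0I cards0.
(* No spanning tree is built. The invariant records what a branch rooted at [u] provides: [D] and
   the rest of [A] are connected, and [u] has a neighbour in the rest unless the rest is empty. *)
have : exists D u, [/\ D \subset A, u \in D, connected e D & connected e (A :\: D)] /\
    [/\ 1 < #|D :&: N| & forall y, y \in A :\: D -> exists2 z, z \in A :\: D & e u z].
  by exists A, u; rewrite setDv; split; split=> //; by [move=> x y; rewrite inE | move=> y; rewrite inE].
move=> {u uA} [D [u]]; have [n] := ubnP #|D|.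
elim: n D u => // n IH D u Dn [[DA uD cD cAD] [D2 At]].
have [all1|/existsNP[b /not_implyP[bD /negP]]] :=
  pselect {in D :\ u, forall b, #|component e (D :\ u) b :&: N| <= 1}.
  by exists D, u.
rewrite -ltnNge; set B := component _ _ _ => B2.
have BD : B \subset D :\ u := component_sub bD.
have uB : u \notin B by apply/negP => /(subsetP BD); rewrite !inE eqxx.
have [w wB uw] := component_attached cD uD bD.
(* The component [B] carries two terminals and becomes the new branch, rooted at the neighbour [w]
   of [u]. *)
apply: (IH B w).
  apply: leq_trans (Dn : #|D| <= n); rewrite [X in _ < X](cardsD1 u) uD add1n ltnS.
  exact: subset_leq_card.
have BA : B \subset A by apply: subset_trans BD (subset_trans (subsetDl _ _) DA).
have ABE : A :\: B = (D :\: B) :|: (A :\: D).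
  apply/setP => x; rewrite in_setU !in_setD; have [xB|_] /= := boolP (x \in B).
    by have /setD1P[_ ->] := subsetP BD _ xB.
  by have [/(subsetP DA)|] := boolP (x \in D).
split; split=> //.
- exact: component_connected.
- rewrite ABE; have cDB := connected_diff_component cD uD bD.
  have [AD0|[z zAD]] := set_0Vmem (A :\: D); first by rewrite AD0 setU0.
  have [y yAD uy] := At z zAD.
  have uDB : u \in D :\: B by rewrite in_setD uB.
  have cU : connected e (u |: (A :\: D)) := connectedU1 eS cAD yAD uy.
  rewrite (_ : _ :|: _ = (D :\: B) :|: (u |: (A :\: D))).
    by apply: connectedU eS cDB cU uDB _; rewrite !inE eqxx.
  by apply/setP => x; rewrite !(in_setU, in_setD, in_set1); case: eqVneq => [->|] //=; rewrite uB uD.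
- by move=> _ _; exists u; rewrite 1?eS // in_setD uB (subsetP DA).
Qed.

End Components.

(** * Fans, books and the cost of putting vertices back *)

Section Terminals.
Variables (T : finType) (e : rel T).
Hypotheses (eS : symmetric e) (eI : irreflexive e).
Implicit Types (W A D N : {set T}) (x y u : T) (P : {set {set T}}).

Lemma disjoint_familyU1 D P : D != set0 -> disjoint_family P ->
  {in P, forall A : {set T}, [disjoint A & D]} ->
  disjoint_family (D |: P) /\ #|D |: P| = #|P|.+1.
Proof.
move=> D0 dP PD; split.
  move=> A B /setU1P[->|AP] /setU1P[->|BP]; rewrite ?eqxx // => AB.
  - by rewrite disjoint_sym PD.
  - exact: PD.
  - exact: dP.
rewrite cardsU1 (_ : D \notin P) //; apply: contraNN D0 => /PD.
by rewrite -setI_eq0 setIid.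
Qed.

(** Distinct terminals other than [u] lie in distinct components of [D :\ u], each attached to [u].
    The strict inequality leaves room for [u] being a terminal itself. *)
Lemma star_family D u N m : connected e D -> u \in D ->
  {in D :\ u, forall b, #|component e (D :\ u) b :&: N| <= 1} -> m < #|D :&: N| ->
  exists P, [/\ m <= #|P|, disjoint_family P & {in P, forall A : {set T},
    [/\ A \subset D :\ u, connected e A, exists2 y, y \in A & e u y
      & exists2 y, y \in A & y \in N]}].
Proof.
move=> cD uD D1 mD; exists (component e (D :\ u) @: ((D :&: N) :\ u)); split.
- rewrite card_in_imset => [|x y].
    by move: mD; rewrite (cardsD1 u); case: (_ \in _); rewrite ?add1n ?ltnS // => /ltnW.
  rewrite !inE => /and3P[xu xD xN] /and3P[yu yD yN] xy.
  have xDu : x \in D :\ u by rewrite !inE xu.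
  apply: (card_le1_eqP (D1 _ xDu)); rewrite in_setI ?xN ?yN andbT;
    by [exact: mem_component | rewrite xy mem_component].
- by move=> _ _ /imsetP[x _ ->] /imsetP[y _ ->]; apply: component_disjoint.
- move=> _ /imsetP[x + ->]; rewrite !inE => /and3P[xu xD xN].
  have xDu : x \in D :\ u by rewrite !inE xu.
  split; [exact: component_sub | exact: component_connected | exact: component_attached |].
  by exists x => //; apply: mem_component.
Qed.

(** Induction on [k], cutting off a lowest branch [D] unless the terminals already lie in different
    components. If [D] carries more than [m] terminals, its root gives the second outcome. Otherwise
    its terminals are discarded at a cost of at most [m], and [D] joins the family if the first
    outcome arises in [W :\: D]. *)
Lemma split_terminals k m W N : N \subset W ->
  [\/ exists P, [/\ k <= #|P|, disjoint_family P &
        {in P, forall A : {set T}, [/\ A \subset W, connected e A & 1 < #|A :&: N|]}],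
      exists2 u, u \in W & exists P, [/\ m <= #|P|, disjoint_family P &
        {in P, forall A : {set T}, [/\ A \subset W :\ u, connected e A,
          exists2 y, y \in A & e u y & exists2 y, y \in A & y \in N]}]
    | exists2 K : {set T}, K \subset N & #|N :\: K| <= k * m /\
        {in K &, forall y z, connect (restrict e W) y z -> y = z}].
Proof.
elim: k W N => [|k IH] W N NW.
  by apply: Or31; exists set0; split=> // [A B|A]; rewrite inE.
have [NU|] := pselect {in N &, forall y z, connect (restrict e W) y z -> y = z}.
  by apply: Or33; exists N => //; rewrite setDv cards0.
move=> /existsNP[y /existsNP[z]] /not_implyP[yN] /not_implyP[zN] /not_implyP[yz].
move=> /eqP Nyz.
pose A := component e W y; have cA : connected e A by apply: component_connected.
have AW : A \subset W by apply/component_sub/(subsetP NW).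
have A2 : 1 < #|A :&: N|.
  by apply/card_gt1P; exists y, z; split; rewrite // !inE ?yN ?zN ?connect0 ?yz.
have [D [u [DA cD cAD D2 [uD D1]]]] := low_branch eS cA A2.
have DW := subset_trans DA AW.
have [mD|Dm] := ltnP m #|D :&: N|.
  apply: Or32; exists u; first exact: subsetP DW _ uD.
  have [P [mP dP PD]] := star_family cD uD D1 mD.
  exists P; split=> // B /PD[BD cB uB BN]; split=> //.
  by apply: subset_trans BD _; apply: setSD.
have [||] := IH _ _ (setSD D NW).
- case=> P [kP dP PW]; apply: Or31; exists (D |: P).
  have [|B /PW[BW _ _]|dDP ->] := @disjoint_familyU1 D P _ dP.
  + by apply/set0Pn; exists u.
  + by move: BW; rewrite subsetD => /andP[].
  split=> // B /setU1P[->//|/PW[BW cB B2]]; split=> //.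
    by apply: subset_trans BW (subsetDl _ _).
  by apply: leq_trans B2 _; apply/subset_leq_card/setIS/subsetDl.
- case=> v /setDP[vW _] [P [mP dP PW]]; apply: Or32; exists v => //.
  exists P; split=> // B /PW[BW cB vB [t tB /setDP[tN _]]]; split=> //; last by exists t.
  by apply: subset_trans BW _; apply/setSD/subsetDl.
- case=> K KN [NK KU]; apply: Or33; exists K; first exact: subset_trans KN (subsetDl _ _).
  split.
    rewrite mulSn; apply: leq_trans (leq_add Dm NK).
    apply: leq_trans (leq_card_setU _ _); apply/subset_leq_card/subsetP => x.
    by rewrite !inE => /andP[-> ->]; rewrite /= !andbT orbN.
  (* Terminals connected in [W] stay connected in [W :\: D]: the rest [A :\: D] is connected, and a
     component of [W] other than [A] avoids [D]. *)
  move=> s t sK tK st; apply: KU => //.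
  have KD w : w \in K -> w \notin D by move=> /(subsetP KN)/setDP[].
  have [sA|sA] := boolP (s \in A).
    have tA : t \in A by move: sA; rewrite !inE => /connect_trans; apply.
    apply: connect_restrictS (setSD D AW) _ _ (cAD _ _ _ _); by rewrite in_setD KD.
  apply: (@connect_restrictS _ _ (component e W s)).
    rewrite subsetD component_sub ?(subsetP NW) //=; last first.
      by have /setDP[] := subsetP KN _ sK.
    have dis : [disjoint component e W s & A].
      by apply: component_disjoint => //; apply: contraNneq sA => sE; rewrite /A -sE mem_component.
    exact: disjointWr DA dis.
  by apply: component_connected; rewrite ?mem_component // inE.
Qed.

(** The terminals are the neighbours of [x]. The first two outcomes of [split_terminals] are a fan
    centred at [x] and a book with spine [x], [u]; the third leaves at most [k * m] edges at [x] to
    delete, each counted twice. *)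
Lemma forest_up_to_bounded k m W x l : ~ has_fan e W k -> ~ has_book e W m -> x \in W ->
  forest_up_to e (W :\ x) l -> forest_up_to e W (l + 2 * (k * m)).
Proof.
move=> Nfan Nbook xW Hl; have NW := nbrs_sub e (W :\ x) x.
have [||] := split_terminals k m NW.
- case=> P [kP dP PW]; case: Nfan; exists x => //; exists P; split=> // A /PW[AW cA A2].
  split=> //; apply: leq_trans A2 _; apply/subset_leq_card/setIS/subsetP => y.
  by rewrite !inE => /andP[].
- case=> u uW [P [mP dP PW]]; case: Nbook; exists x, u; move: uW; rewrite !inE => /andP[ux uW].
  split=> //; first by rewrite eq_sym.
  exists P; split=> // A /PW[AW cA uA [y yA]]; rewrite inE => /andP[_ xy]; split=> //.
  by exists y.
case=> K KN [NK KU]; apply: forest_up_to_leq (forest_up_to_vertex eS eI xW KN KU Hl).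
by rewrite leq_add2l leq_mul2l.
Qed.

Lemma has_fanS W W' k : W' \subset W -> has_fan e W' k -> has_fan e W k.
Proof.
move=> WW' [x xW [P [kP dP PW]]]; exists x; first exact: subsetP xW.
exists P; split=> // A /PW[AW cA A2]; split=> //; apply: subset_trans AW _; exact: setSD.
Qed.

Lemma has_bookS W W' k : W' \subset W -> has_book e W' k -> has_book e W k.
Proof.
move=> WW' [x [u [xW uW xu [P [kP dP PW]]]]]; exists x, u; split; rewrite ?(subsetP WW') //.
exists P; split=> // A /PW[AW cA uA xA]; split=> //; apply: subset_trans AW _.
by do 2!apply: setSD.
Qed.

Lemma forest_up_to_diff k m W A l : ~ has_fan e W k -> ~ has_book e W m -> A \subset W ->
  forest_up_to e (W :\: A) l -> forest_up_to e W (l + #|A| * (2 * (k * m))).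
Proof.
have [n] := ubnP #|A|; elim: n A l => // n IH A l An Nfan Nbook AW Hl.
have [A0|[x xA]] := set_0Vmem A; first by move: Hl; rewrite A0 setD0 cards0 mul0n addn0.
have xW := subsetP AW _ xA.
rewrite (cardsD1 x) xA add1n mulSn addnA in An *; apply: IH => //.
  by apply: subset_trans (subsetDl _ _) AW.
have WE : W :\: A = (W :\: (A :\ x)) :\ x.
  by apply/setP => y; rewrite !inE; case: eqVneq => //= ->; rewrite xA.
rewrite WE in Hl; apply: forest_up_to_bounded Hl; rewrite ?inE ?eqxx //.
- by apply/(contra_not _ Nfan)/has_fanS/subsetDl.
- by apply/(contra_not _ Nbook)/has_bookS/subsetDl.
Qed.

End Terminals.

(** * Short cycles *)

Section Short_cycle.
Variables (T : finType) (e : rel T).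
Hypotheses (eS : symmetric e) (eI : irreflexive e).
Implicit Types (W A S : {set T}) (x y v : T).

Lemma connected1 x : connected e [set x].
Proof. by move=> y z /set1P-> /set1P->; apply: connect0. Qed.

(** Endpoints grow outwards from [v]: while small sets are acyclic, each endpoint has two new
    neighbours and no two endpoints share one, so their number doubles. [A x] stands for a path from
    [v] to [x], recorded only as a set connected with and without [x]. The constant [2 * r + 3]
    covers two such sets of at most [r + 1] vertices and a common new neighbour. *)
Lemma moore_bound W v r : v \in W -> {in W, forall x, 3 <= #|nbrs e W x|} ->
  (forall A, A \subset W -> #|A| <= (2 * r) + 3 -> acyclic (restrict e A)) ->
  2 ^ r <= #|W|.
Proof.
move=> vW deg3 small.
suff [S [_ [SW rS _]]] : exists S (A : T -> {set T}), [/\ S \subset W, 2 ^ r <= #|S| &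
    {in S, forall x, [/\ A x \subset W, #|A x| <= r + 2, connected e (A x),
       connected e (A x :\ x) & [/\ v \in A x, x \in A x & x != v]]}].
  exact: leq_trans rS (subset_leq_card SW).
elim: {-2}r (leqnn r) => [_|i IH ir].
  have /card_gt0P[w] : 0 < #|nbrs e W v| by apply: leq_trans (deg3 v vW).
  rewrite inE => /andP[wW vw]; have wv : w != v by apply: contraTneq vw => ->; rewrite eI.
  exists [set w], (fun _ => [set w; v]); split=> [||x /set1P->]; rewrite ?sub1set ?cards1 //.
  rewrite cards2 wv setU1K ?in_set1 //; split; rewrite ?set21 ?set22 //.
  - by apply/subsetP => z /set2P[]->.
  - have wv1 : e w v by rewrite eS.
    exact: (connectedU1 eS (@connected1 v) (set11 v) wv1).
  - exact: connected1.
have [S [A [SW iS AP]]] := IH (ltnW ir).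
pose F x := nbrs e W x :\: A x.
pose X := [set p : T * T | (p.1 \in S) && (p.2 \in F p.1)].
have F2 x : x \in S -> 2 <= #|F x|.
  move=> xS; have [AW Ai cA cAx [vA xA xv]] := AP x xS.
  (* Two neighbours of [x] in its own set would close a cycle, since [A x :\ x] is connected. *)
  have A1 : #|nbrs e W x :&: A x| <= 1.
    rewrite leqNgt; apply/negP => /card_gt1P[y [z [+ + yz]]].
    rewrite !inE => /andP[/andP[yW xy] yA] /andP[/andP[zW xz] zA].
    have Nx u : e x u -> u \in A x -> u \in A x :\ x.
      by move=> xu uA; rewrite !inE uA andbT; apply: contraTneq xu => ->; rewrite eI.
    have xN : x \notin A x :\ x by rewrite setD11.
    apply: (connected_cycle eS eI cAx xN (Nx _ xy yA) (Nx _ xz zA) yz xy xz).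
    by rewrite setD1K //; apply: small => //; apply: leq_trans Ai _; move: ir; clear; lia.
  have := deg3 x (subsetP SW x xS); rewrite -(cardsID (A x)) => N3.
  by rewrite -(leq_add2l 1); apply: leq_trans N3 _; rewrite leq_add2r.
have FP x y : y \in F x -> [/\ y \in W, e x y & y \notin A x].
  by rewrite !inE => /and3P[].
have Finj x x' y : x \in S -> x' \in S -> y \in F x -> y \in F x' -> x = x'.
  move=> xS x'S /FP[yW xy yA] /FP[_ x'y yA']; apply: contrapT => /eqP xx'.
  have [AW Ai cA _ [vA xA _]] := AP x xS; have [AW' Ai' cA' _ [vA' xA' _]] := AP x' x'S.
  have cU := connectedU eS cA cA' vA vA'.
  have yN : y \notin A x :|: A x' by rewrite inE negb_or yA.
  have [xU xU'] : x \in A x :|: A x' /\ x' \in A x :|: A x'.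
    by rewrite !inE xA xA' orbT.
  apply: (connected_cycle eS eI cU yN xU xU' xx'); rewrite 1?eS //.
  apply: small; first by rewrite !subUset AW AW' sub1set yW.
  rewrite cardsU1 yN add1n; have [+ _] := leq_card_setU (A x) (A x').
  move: #|A x :|: A x'| #|A x| #|A x'| Ai Ai' ir; clear; lia.
(* Each new endpoint inherits the set of the endpoint it was reached from; on the new [S] the
   default of [odflt] never occurs. *)
exists (snd @: X), (fun y => y |: A (odflt y [pick x in S | y \in F x])); split.
- by apply/subsetP => _ /imsetP[[x y] + ->]; rewrite inE => /andP[_ /FP[]].
- rewrite card_in_imset => [|[x y] [x' y']].
    rewrite -sum1dep_card -(pair_big_dep [in S] (fun x => [in F x]) (fun _ _ => 1)) /=.
    rewrite expnSr; apply: leq_trans (_ : #|S| * 2 <= _); first by rewrite leq_mul2r iS.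
    by rewrite -sum_nat_const; apply: leq_sum => x xS; rewrite sum1_card F2.
  move=> /[1!inE]/andP[/= xS xy] /[1!inE]/andP[/= x'S x'y'] yy'.
  by move: x'y'; rewrite -yy' => x'y; rewrite (Finj x x' y).
move=> _ /imsetP[[x0 y] /[1!inE]/andP[/= x0S x0y] ->] /=.
case: pickP => [x /andP[xS xy]|/(_ x0)]; last by rewrite x0S x0y.
have [AW Ai cA cAx [vA xA xv]] := AP x xS; have [yW exy yA] := FP _ _ xy => /=.
split.
- by rewrite subUset sub1set yW.
- by rewrite cardsU1 yA add1n.
- by apply: connectedU1 xA _ => //; rewrite eS.
- by rewrite setU1K.
- by rewrite !inE vA eqxx orbT; split=> //; apply: contraNneq yA => ->.
Qed.

End Short_cycle.

(** * Suppressing vertices of degree two *)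

Definition has_disjoint_cycles (T : finType) (e : rel T) (W : {set T}) k : Prop :=
  exists P : {set {set T}}, [/\ k <= #|P|, disjoint_family P &
    {in P, forall A : {set T}, A \subset W /\ ~ acyclic (restrict e A)}].

Section Suppression.
Variables (T : finType) (e : rel T).
Hypotheses (eS : symmetric e) (eI : irreflexive e).
Implicit Types (W A : {set T}).

(** Contrapositively, a cycle using the new edge [ab] can be rerouted through [v]. *)
Lemma acyclic_add_edge A v a b : v \notin A -> e v a -> e v b ->
  acyclic (restrict e (v |: A)) -> acyclic (restrict (add_edge e a b) A).
Proof.
move=> vA va vb fA; set f := restrict e (v |: A) in fA.
set g := restrict (add_edge e a b) A.
have [fS fI] : symmetric f /\ irreflexive f by split; [apply: restrict_sym | apply: restrict_irr].
have gS : symmetric g by apply/restrict_sym/add_edge_sym.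
have gI : irreflexive g by apply/restrict_irr/add_edge_irr.
have fg u w : g u w -> f u w \/ [set u; w] = [set a; b].
  case/and3P=> /orP[euw uA wA|/andP[_ /eqP->]]; last by right.
  by left; rewrite /f /restrict euw !inE uA wA !orbT.
have gv u w : g u w -> [set u; w] = [set a; b] -> f v u /\ f v w.
  case/and3P=> _ uA wA /set2_inj[[ua wb]|[ub wa]]; subst;
    by rewrite /f /restrict !inE uA wA eqxx !orbT ?va ?vb.
apply: acyclicP => // x y z xy xz yz; have xv : x != v.
  by case/and3P: xy => _ xA _; apply: contraNneq vA => <-.
have yzf : connect (restrict f [set~ x]) y z.
  apply: connect_sub yz => u w /and3P[guw ux wx]; have [fuw|uwE] := fg _ _ guw.
    by apply: connect1; rewrite /restrict fuw ux.
  have [vu vw] := gv _ _ guw uwE; apply: (@connect_trans _ _ v); apply: connect1.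
    by rewrite /restrict fS vu ux !inE eq_sym xv.
  by rewrite /restrict vw wx !inE eq_sym xv.
(* If [x] and [w] are the ends of the new edge, [v] is adjacent to both, hence joined to [u] off
   [x]; acyclicity then forces [u = v], which lies outside [A]. *)
have vlink u w : connect (restrict f [set~ x]) u w -> g x u -> g x w -> f x u ->
    [set x; w] = [set a; b] -> u = w.
  move=> uw xu xw fxu xwE; have [vx vw] := gv _ _ xw xwE.
  have uv : u = v.
    apply: (@acyclic_nbrs _ f x) => //; first by rewrite fS.
    apply: connect_trans uw (connect1 _); rewrite /restrict fS vw !inE [v == x]eq_sym xv andbT.
    by apply: contraTneq xw => ->; rewrite gI.
  by case/and3P: xu => _ _; rewrite uv (negPf vA).
have [fxy|xyE] := fg _ _ xy; have [fxz|xzE] := fg _ _ xz.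
- exact: acyclic_nbrs fA fS fI fxy fxz yzf.
- exact: vlink yzf xy xz fxy xzE.
- apply: esym; apply: vlink xz xy fxz xyE.
  by rewrite (sym_connect_sym (restrict_sym _ fS)).
- have : [set x; y] = [set x; z] by rewrite xyE.
  by move=> /set2_inj[[]|[<- <-]].
Qed.

(** The vertex [v] is added to the member containing [a]; there is at most one, so disjointness
    persists. A member without [a] cannot use the new edge. *)
Lemma has_disjoint_cycles_suppress W v a b k : v \in W -> e v a -> e v b ->
  has_disjoint_cycles (add_edge e a b) (W :\ v) k -> has_disjoint_cycles e W k.
Proof.
move=> vW va vb [P [kP dP PW]].
pose h (A : {set T}) := if a \in A then v |: A else A.
have AW A : A \in P -> A \subset W /\ v \notin A.
  by move=> /PW[]; rewrite subsetD1 => /andP[].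
have hD A : A \in P -> h A :\ v = A.
  move=> /AW[_ vA]; rewrite /h; case: ifP => _; first by rewrite setU1K.
  by apply/setDidPl; rewrite disjoint_sym disjoints1.
exists (h @: P); split.
- by rewrite card_in_imset // => A B AP BP E; rewrite -(hD A) // E hD.
- move=> _ _ /imsetP[A AP ->] /imsetP[B BP ->] AB.
  have {}AB : A != B by apply: contraNneq AB => ->.
  have mem_h C x : x \in h C -> x \in C \/ x = v /\ a \in C.
    by rewrite /h; case: ifP => [aC /setU1P[->|]|]; auto.
  have AB0 x : x \in A -> x \in B -> False.
    by move=> xA xB; have := disjointFr (dP _ _ AP BP AB) xA; rewrite xB.
  have [[_ vA] [_ vB]] := (AW _ AP, AW _ BP).
  rewrite disjoint_subset; apply/subsetP => x /mem_h xA; apply/negP => /mem_h xB.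
  case: xA xB => [xA|[-> aA]] [xB|[xv aB]].
  + exact: AB0 xA xB.
  + by rewrite xv (negPf vA) in xA.
  + by rewrite (negPf vB) in xB.
  + exact: AB0 aA aB.
- move=> _ /imsetP[A AP ->]; have [AsW vA] := AW _ AP; have [_ cA] := PW _ AP.
  rewrite /h; case: (boolP (a \in A)) => aA.
    split; first by rewrite subUset sub1set vW.
    by apply: contra_not cA; apply: acyclic_add_edge.
  split=> //; apply: contra_not cA; apply: acyclic_sub => x y /and3P[xy xA yA].
  rewrite /restrict xA yA !andbT; case/orP: xy => // /andP[_ /eqP E].
  by have := set21 a b; rewrite -E => /set2P[] aE; rewrite aE ?xA ?yA in aA.
Qed.

End Suppression.

Lemma exp2_linear_bound a b : exists t0, forall t, 2 ^ t <= a + t * b -> t <= t0.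
Proof.
(* Beyond this value [t * t], which is at most [2 ^ t] from 4 on, already exceeds [a + t * b]. *)
exists (a + b + 4) => t; rewrite leqNgt => le; apply: contraTleq le => lt.
have sq n : 4 <= n -> n * n <= 2 ^ n.
  elim: n => // n IH; rewrite leq_eqVlt => /predU1P[<-//|n4].
  have := IH n4; rewrite expnS; nia.
have := sq t; nia.
Qed.

(** * Packing disjoint cycles *)

Section Packing.
Variables (Gs : graph_class) (kf kb : nat).
Hypothesis Gs_minor : forall G H, Gs G -> topological_minor H G -> Gs H.
Hypothesis Gs_fan : forall (T : finType) (e : rel T) W, symmetric e -> irreflexive e ->
  Gs (graph_on e W) -> ~ has_fan e W kf.
Hypothesis Gs_book : forall (T : finType) (e : rel T) W, symmetric e -> irreflexive e ->
  Gs (graph_on e W) -> ~ has_book e W kb.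

(** The cost of putting back one vertex, from [forest_up_to_bounded]. *)
Let d := 2 * (kf * kb).

Let packing k g := forall (T : finType) (e : rel T) W, symmetric e -> irreflexive e ->
  Gs (graph_on e W) -> forest_up_to e W g \/ has_disjoint_cycles e W k.

(** The statement for [k] is applied to [W :\: A]: either the cycles found there are joined by the
    one in [A], or the vertices of [A] are put back at cost [d] each. *)
Lemma remove_cycle k g (T : finType) (e : rel T) (W A : {set T}) :
  packing k g -> symmetric e -> irreflexive e -> Gs (graph_on e W) ->
  A \subset W -> ~ acyclic (restrict e A) ->
  forest_up_to e W (g + #|A| * d) \/ has_disjoint_cycles e W k.+1.
Proof.
move=> pk eS eI GW AW cA.
have GWA : Gs (graph_on e (W :\: A)).
  by apply: Gs_minor GW _; apply: topological_minor_graph_onS => //; apply: subsetDl.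
have [fWA|[P [kP dP PW]]] := pk _ _ _ eS eI GWA.
  left; apply: forest_up_to_diff fWA => //; [exact: Gs_fan GW | exact: Gs_book GW].
right; exists (A |: P).
have [|B /PW[BW _]|dAP ->] := @disjoint_familyU1 _ A P _ dP.
- by apply: contra_notN cA => /eqP-> [|x c] [//= _ _]; case: c => [|y c] /andP[/and3P[_]]; rewrite inE.
- by move: BW; rewrite subsetD => /andP[].
split=> // B /setU1P[->//|/PW[BW cB]]; split=> //.
by apply: subset_trans BW (subsetDl _ _).
Qed.

Lemma short_cycle (T : finType) (e : rel T) (W : {set T}) r : symmetric e -> irreflexive e ->
  W != set0 -> {in W, forall x, 3 <= #|nbrs e W x|} -> #|W| < 2 ^ r ->
  exists A : {set T}, [/\ A \subset W, ~ acyclic (restrict e A) & #|A| <= 2 * r + 3].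
Proof.
move=> eS eI /set0Pn[v vW] deg3; rewrite ltnNge => /negP Wr.
apply: contrapT => noA; apply: Wr; apply: moore_bound vW deg3 _ => // A AW Ar.
by apply: contrapT => cA; apply: noA; exists A.
Qed.

Lemma forest_up_to_set0 (T : finType) (e : rel T) l : forest_up_to e set0 l.
Proof.
exists (fun _ _ => false); split=> //.
  by move=> [|x [|y c]] [].
by rewrite eq_card0 // => p; rewrite !inE /restrict inE andbF.
Qed.

(** The inner induction on the size of [W] lets [e] vary, because suppression adds an edge. Removing
    leaves and suppressing vertices keep the bound [g']; otherwise a cycle on boundedly many
    vertices is removed, or the distance to a forest was never an issue because [k.+1] cycles
    appear. *)
Lemma bounded_or_disjoint_cycles k : exists g, packing k g.
Proof.
elim: k => [|k [g pk]].
  exists 0 => T e W _ _ _; right; exists set0; split=> // [A B|A]; by rewrite inE.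
(* This is the inequality [2 ^ t <= g + (2 * t + 5) * d] that arises at minimum degree 3, with [t]
   the logarithm of the size. *)
have [t0 t0P] := exp2_linear_bound (g + 5 * d) (2 * d).
pose g' := g + (2 * t0 + 5) * d; exists g' => T e W eS eI GW.
have short (f : rel T) (W' A : {set T}) : symmetric f -> irreflexive f ->
    Gs (graph_on f W') -> A \subset W' ->
    ~ acyclic (restrict f A) -> #|A| <= 2 * t0 + 5 ->
    forest_up_to f W' g' \/ has_disjoint_cycles f W' k.+1.
  move=> fS fI GW' AW cA At; have [fW|] := remove_cycle pk fS fI GW' AW cA; last by right.
  by left; apply: forest_up_to_leq fW; rewrite leq_add2l leq_mul2r At orbT.
have [n] := ubnP #|W|; elim: n e W eS eI GW => // n IH e W eS eI GW Wn.
have Wv v : v \in W -> #|W :\ v| < n.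
  by move=> vW; move: Wn; rewrite (cardsD1 v) vW.
have GWv v : Gs (graph_on e (W :\ v)).
  by apply: Gs_minor GW _; apply: topological_minor_graph_onS => //; apply: subsetDl.
have [->|W0] := eqVneq W set0; first by left; apply: forest_up_to_set0.
have [[v vW v1]|leafless] := pselect (exists2 v, v \in W & #|nbrs e W v| <= 1).
  have [fW|[P [kP dP PW]]] := IH e (W :\ v) eS eI (GWv v) (Wv v vW).
    by left; apply: forest_up_to_leaf fW.
  right; exists P; split=> // A /PW[AW cA]; split=> //.
  by apply: subset_trans AW (subsetDl _ _).
have [[v vW v2]|deg3] := pselect (exists2 v, v \in W & #|nbrs e W v| == 2).
  have /cards2P[a [b [ab NE]]] := v2.
  have [/andP[aW va] /andP[bW vb]] : (a \in W) && e v a /\ (b \in W) && e v b.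
    by have := set21 a b; have := set22 a b; rewrite -NE !inE.
  have av : a != v by apply: contraTneq va => ->; rewrite eI.
  have bv : b != v by apply: contraTneq vb => ->; rewrite eI.
  have [eab|Neab] := boolP (e a b).
    have cab : connected e [set a; b] := connectedU1 eS (@connected1 _ e b) (set11 b) eab.
    have vab : v \notin [set a; b] by rewrite !inE ![v == _]eq_sym negb_or av.
    apply: (@short e W (v |: [set a; b])) => //.
    - by apply/subsetP => x; rewrite !inE => /or3P[] /eqP->.
    - by apply: connected_cycle ab va vb => //; rewrite ?set21 ?set22.
    - by rewrite cardsU1 vab cards2 ab; lia.
  have Gab : Gs (graph_on (add_edge e a b) (W :\ v)).
    rewrite (_ : W :\ v = W :\: [set x in [:: v]]); last by apply/setP => x; rewrite !inE.
    apply: Gs_minor GW _; apply: topological_minor_add_edge => //=; rewrite ?andbT //.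
      by rewrite !inE negb_or av ab [v == b]eq_sym bv.
    by rewrite eS va vb.
  have [fW|cW] := IH _ _ (add_edge_sym eS a b) (add_edge_irr eI a b) Gab (Wv v vW).
    by left; apply: forest_up_to_suppress NE ab Neab fW.
  by right; apply: has_disjoint_cycles_suppress vW va vb cW.
have {}deg3 : {in W, forall x, 3 <= #|nbrs e W x|}.
  move=> x xW; rewrite ltnNge leq_eqVlt negb_or ltnS; apply/andP; split; apply/negP.
    by move=> x2; apply: deg3; exists x.
  by move=> x1; apply: leafless; exists x.
(* The size lies between [2 ^ t] and [2 ^ t.+1], so the short cycle has at most
   [2 * t.+1 + 3 = 2 * t + 5] vertices. *)
have [W2 Wt] := andP (trunc_log_bounds (isT : 1 < 2) (etrans (card_gt0 W) W0)).
set t := trunc_log 2 #|W| in W2 Wt.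
have [A [AW cA At]] := short_cycle eS eI W0 deg3 Wt.
have [fW|] := remove_cycle pk eS eI GW AW cA; last by right.
(* The number of deletions needed is at least [#|W|] but at most [g + #|A| * d]; this bounds [t],
   and [A] is small enough for [short]. *)
suff tt0 : t <= t0 by apply: short AW cA _ => //; apply: leq_trans At _; lia.
apply: t0P; apply: leq_trans W2 _; apply: leq_trans (forest_up_to_card eI deg3 fW) _.
rewrite -addnA leq_add2l mulnA -mulnDl leq_mul2r; apply/orP; right.
by apply: leq_trans At _; lia.
Qed.

End Packing.

(** * Fans as topological minors *)

Definition o0 : complete 3 := @Ordinal 3 0 isT.
Definition o1 : complete 3 := @Ordinal 3 1 isT.
Definition o2 : complete 3 := @Ordinal 3 2 isT.

Lemma ord3P (x : complete 3) : [\/ x = o0, x = o1 | x = o2].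
Proof.
case: x => [[|[|[|//]]] lt]; [apply: Or31 | apply: Or32 | apply: Or33]; exact: val_inj.
Qed.

(** The private vertex [r] fixes the copy in which [p] and [p'] can lie. *)
Lemma fan_vert_inj (G : sgraph) (S : {set G}) k (p p' r : Fan S k) :
  fan_base p = fan_base p' -> fan_base r \notin S ->
  fan_same_copy p r -> fan_same_copy p' r -> p = p'.
Proof.
case: r => [s|[i x]] /=; first by rewrite (valP s).
case: p => [s|[j y]]; case: p' => [s'|[j' y']] //= E _.
- by move=> _ _; congr inl; apply: val_inj.
- by move=> _ _; have yS := valP y'; rewrite -[val y']E (valP s) in yS.
- by move=> _ _; have yS := valP y; rewrite [val y]E (valP s') in yS.
- by move=> /eqP-> /eqP->; congr (inr (_, _)); apply: val_inj.
Qed.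

Section Fan_minor.
Variables (T : finType) (e : rel T) (W : {set T}) (S : {set complete 3}) (k : nat).
Variables (X : 'I_k -> complete 3 -> T) (q : 'I_k -> seq T) (A : 'I_k -> {set T}).
Hypotheses (eS : symmetric e) (eI : irreflexive e).

(** One embedding serves all three fans. [X i] places the triangle of copy [i]: its edges at [o0]
    stay edges, and [o1 o2] becomes the path through [q i]. As [o2] is never shared, that path is
    private to the copy and fits in [A i]. The index [i0] is used to place the shared vertices. *)
Lemma fan_minor (i0 : 'I_k) :
  o2 \notin S ->
  (forall i j s, s \in S -> X i s = X j s) ->
  (forall i s, s \in S -> X i s \in W /\ forall j, X i s \notin A j) ->
  (forall i x, x \notin S -> X i x \in A i) ->
  (forall i, all [in A i] (q i)) ->
  (forall i, A i \subset W) ->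
  (forall i j, i != j -> [disjoint A i & A j]) ->
  (forall i, [/\ e (X i o0) (X i o1), e (X i o0) (X i o2),
     path e (X i o1) (rcons (q i) (X i o2)) & uniq (X i o0 :: X i o1 :: rcons (q i) (X i o2))]) ->
  topological_minor (Fan S k) (graph_on e W).
Proof.
move=> oS Xeq XS XA qA AW Adisj cyc.
have Adis i j x : x \in A i -> x \in A j -> i = j.
  move=> xi xj; apply/eqP; apply: contraTT isT => /Adisj dij.
  by have := disjointFr dij xi; rewrite xj.
have XqU i : [/\ X i o0 != X i o1, X i o0 != X i o2 & X i o1 != X i o2] /\
    [/\ X i o0 \notin q i, X i o1 \notin q i, X i o2 \notin q i & uniq (q i)].
  have [_ _ _] := cyc i.
  rewrite !cons_uniq rcons_uniq !(in_cons, mem_rcons) !negb_or -!andbA.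
  by case/and5P=> -> -> -> -> /and3P[-> -> ->].
have XU i : uniq [:: X i o0; X i o1; X i o2].
  by have [[N01 N02 N12] _] := XqU i; rewrite /= !inE negb_or N01 N02 N12.
have Xi i : injective (X i).
  move=> x y; have XE z : X i z = nth (X i o0) [:: X i o0; X i o1; X i o2] z.
    by case: (ord3P z) => ->.
  by move/eqP; rewrite XE [X i y]XE nth_uniq // => /eqP; apply: val_inj.
have Xq i j x : X i x \notin q j.
  apply/negP => xq; have xA := allP (qA j) _ xq.
  have [xS|xS] := boolP (x \in S); first by have [_ /(_ j)] := XS i x xS; rewrite xA.
  have ij : i = j := Adis _ _ _ (XA _ _ xS) xA.
  have [_ [N0 N1 N2 _]] := XqU j; move: xq; rewrite ij.
  by case: (ord3P x) => ->; apply/negP.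
pose phi (p : Fan S k) := match p with inl s => X i0 (val s) | inr r => X r.1 (val r.2) end.
have phiE p i x (xS : x \notin S) : fan_same_copy p (inr (i, exist _ x xS)) -> phi p = X i (fan_base p).
  by case: p => [s _|[j y] /eqP /=->] //=; apply/Xeq/valP.
have phi_adj p p' : adj p p' -> exists i, phi p = X i (fan_base p) /\ phi p' = X i (fan_base p').
  case: p p' => [s|[i x]] [s'|[j y]] /andP[_ c].
  - by exists i0.
  - by exists j; split=> //=; apply/Xeq/valP.
  - by exists i; split=> //=; apply/Xeq/valP.
  - by exists i; rewrite /= (eqP (c : i == j)).
(* The copy is read off at the [o2] end, since [o1] may be shared. *)
pose qc (p : Fan S k) := match p with inl _ => [::] | inr r => q r.1 end.
pose P (p p' : Fan S k) :=
  if (fan_base p == o1) && (fan_base p' == o2) then qc p' else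
  if (fan_base p == o2) && (fan_base p' == o1) then rev (qc p) else [::].
have qcE (p p' : Fan S k) : adj p p' -> fan_base p = o1 -> fan_base p' = o2 ->
    exists i, [/\ qc p' = q i, phi p = X i o1 & phi p' = X i o2].
  case: p' => [s' _ _ /= E|[i x] pp' pE p'E]; first by case/negP: oS; rewrite -E; apply: valP s'.
  exists i; split=> //=; last by rewrite -p'E.
  by rewrite -pE; case/andP: pp' => _; case: x p'E => x xS /= _; apply: phiE.
have P12 (p p' : Fan S k) w : adj p p' -> w \in P p p' -> exists r r' : Fan S k,
    [/\ [set p; p'] = [set r; r'], adj r r', fan_base r = o1, fan_base r' = o2 & w \in qc r'].
  rewrite /P => pp'; case: ifP => [/andP[/eqP pE /eqP p'E] wq|_]; first by exists p, p'.
  case: ifP => [/andP[/eqP pE /eqP p'E]|//]; rewrite mem_rev => wq.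
  by exists p', p; split=> //; [rewrite setUC | rewrite adj_sym].
apply: (@topological_minor_graph_on _ _ _ eS eI (Fan S k) phi P).
- move=> p p'; case: p p' => [s|[i x]] [s'|[j y]] /=.
  + by move/Xi => ss'; congr inl; apply: val_inj.
  + move=> E; have [_ /(_ j)/negP[]] := XS i0 _ (valP s).
    by rewrite [X i0 _]E; apply/XA/(valP y).
  + move=> E; have [_ /(_ i)/negP[]] := XS i0 _ (valP s').
    by rewrite -[X i0 _]E; apply/XA/(valP x).
  + move=> E; have ij : i = j.
      by apply: (Adis _ _ (X i (val x))); [apply/XA/(valP x) | rewrite [X i _]E; apply/XA/(valP y)].
    by rewrite -ij in E *; congr (inr (_, _)); apply/val_inj/(Xi i).
- case=> [s|[i x]] /=; first by case: (XS i0 _ (valP s)).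
  by apply/(subsetP (AW i))/XA/(valP x).
- move=> p p' pp'; have p'p : adj p' p by rewrite adj_sym.
  have bpp' : fan_base p != fan_base p' by case/andP: pp'.
  rewrite /P; case: (boolP ((fan_base p == o1) && (fan_base p' == o2))) => [/andP[/eqP pE /eqP p'E]|N12].
    have [i [qE phip phip']] := qcE _ _ pp' pE p'E; have [_ _ pathi _] := cyc i.
    have [_ [_ _ _ qU]] := XqU i; rewrite pE p'E /= qE phip phip'; split=> //.
      by apply/allP => w /(allP (qA i)); apply/subsetP/AW.
    by case=> [s|[j y]]; apply: Xq.
  case: (boolP ((fan_base p == o2) && (fan_base p' == o1))) => [/andP[/eqP pE /eqP p'E]|N21].
    have [i [qE phip' phip]] := qcE _ _ p'p p'E pE; have [_ _ pathi _] := cyc i.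
    have [_ [_ _ _ qU]] := XqU i; rewrite pE p'E /= qE phip phip' revK all_rev rev_uniq; split=> //.
    + by apply/allP => w /(allP (qA i)); apply/subsetP/AW.
    + move: pathi; rewrite -(eq_path (e := fun x y => e y x)); last by move=> u v; apply: eS.
      by rewrite -rev_path last_rcons belast_rcons rev_cons.
    + by case=> [s|[j y]]; rewrite mem_rev; apply: Xq.
  rewrite [_ && _]andbC (negPf N21) [_ && _]andbC (negPf N12); split=> //=; rewrite andbT.
  have [i [-> ->]] := phi_adj _ _ pp'; have [e01 e02 _ _] := cyc i.
  by case: (ord3P (fan_base p)) bpp' N12 N21 => ->; case: (ord3P (fan_base p')) => -> // _ _ _;
    rewrite // eS.
- move=> p1 p1' p2 p2' a1 a2 N w /(P12 _ _ _ a1)[r1 [r1' [E1 b1 r1E r1'E w1]]].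
  apply/negP => /(P12 _ _ _ a2)[r2 [r2' [E2 b2 r2E r2'E w2]]]; case/eqP: N; rewrite E1 E2.
  case: r1' E1 b1 r1'E w1 => [//|[i x]] E1 b1 /= xE wi.
  case: r2' E2 b2 r2'E w2 => [//|[j y]] E2 b2 /= yE wj.
  have ij : i = j by apply: (Adis _ _ w); apply: (allP (qA _)).
  rewrite -{}ij in E2 b2 wj *; have xy : x = y by apply: val_inj; apply: etrans xE (esym yE).
  rewrite -{}xy in E2 b2 *; congr [set _; _].
  case/andP: b1 => _ s1; case/andP: b2 => _ s2.
  by apply: fan_vert_inj s1 s2; rewrite ?r1E ?r2E //= (valP x).
Qed.

End Fan_minor.

Lemma family_index (T : finType) (P : {set {set T}}) k : k <= #|P| -> disjoint_family P ->
  exists A : 'I_k -> {set T}, (forall i, A i \in P) /\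
    (forall i j, i != j -> [disjoint A i & A j]).
Proof.
move=> kP dP; have lt (i : 'I_k) : i < size (enum P) by rewrite -cardE (leq_trans _ kP).
have AP (i : 'I_k) : nth set0 (enum P) i \in P by rewrite -mem_enum mem_nth.
exists (fun i : 'I_k => nth set0 (enum P) i); split=> // i j ij; apply: dP => //.
by rewrite nth_uniq ?enum_uniq.
Qed.

Lemma connect_restrict_path (T : finType) (e : rel T) (B : {set T}) y z :
  connect (restrict e B) y z -> y \in B -> y != z -> exists q,
    [/\ path e y (rcons q z), uniq (y :: rcons q z), all [in B] q & z \in B].
Proof.
move=> yz yB Nyz; have zB := connect_restrict_mem yz yB.
have [p [pe pU pB zE]] := connect_restrictP _ _ yB yz.
case/lastP: p pe pU pB zE => [|p w]; first by move=> _ _ _ /= zy; rewrite zy eqxx in Nyz.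
rewrite last_rcons => pe pU pB zE; subst w; exists p; split=> //.
by move: pB; rewrite all_rcons => /andP[].
Qed.

Definition triple (T : Type) (d : T * T * T * seq T) (x : complete 3) : T :=
  nth d.1.1.1 [:: d.1.1.1; d.1.1.2; d.1.2] x.

Section Minors.
Variables (T : finType) (e : rel T) (W : {set T}).
Hypotheses (eS : symmetric e) (eI : irreflexive e).

Lemma disjoint_cycles_minor k : 0 < k -> has_disjoint_cycles e W k ->
  topological_minor (Fan (set0 : {set complete 3}) k) (graph_on e W).
Proof.
move=> k0 [P [kP dP PW]]; have [A [AP Adisj]] := family_index kP dP.
have data i : exists d : T * T * T * seq T,
    let: (a, b, c, q) := d in [/\ e a b, e a c, path e b (rcons q c),
      uniq (a :: b :: rcons q c) & all [in A i] (a :: b :: rcons q c)].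
  have [AW cA] := PW _ (AP i).
  have [x [y [z [xy xz yz yzc]]]] := not_acyclic cA (restrict_sym _ eS) (restrict_irr _ eI).
  have yx : y \in A i :\ x.
    by case/and3P: xy => xy _ yA; rewrite !inE yA andbT; apply: contraTneq xy => ->; rewrite eI.
  have yzc' : connect (restrict e (A i :\ x)) y z.
    apply: connect_mono yzc => u w; rewrite restrictI.
    by apply: restrictS => //; apply/subsetP => v; rewrite !inE andbC.
  have [q [pq qU qA zA]] := connect_restrict_path yzc' yx yz.
  have qAx : all [in A i :\ x] (y :: rcons q z) by rewrite /= yx all_rcons zA qA.
  exists (x, y, z, q); split=> //; try by [case/and3P: xy | case/and3P: xz].
    rewrite cons_uniq qU andbT; apply/negP => /(allP qAx); by rewrite !inE eqxx.
  have xA : x \in A i by case/and3P: xy.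
  apply/allP => w; rewrite inE => /predU1P[->//|/(allP qAx)].
  by rewrite !inE => /andP[].
have [d dP'] := fin_all_exists data.
apply: (@fan_minor _ e W set0 k (fun i => triple (d i)) (fun i => (d i).2) A eS eI (Ordinal k0)).
- by rewrite inE.
- by move=> i j s; rewrite inE.
- by move=> i s; rewrite inE.
- move=> i x _; move: (dP' i); case: (d i) => [[[a b] c] q] /= [_ _ _ _ ].
  rewrite /triple all_rcons => /and4P[aA bA cA _].
  by case: (ord3P x) => ->.
- move=> i; move: (dP' i); case: (d i) => [[[a b] c] q] /= [_ _ _ _ ].
  by rewrite all_rcons => /and4P[].
- by move=> i; case: (PW _ (AP i)).
- exact: Adisj.
- by move=> i; move: (dP' i); case: (d i) => [[[a b] c] q] /= [].
Qed.

Lemma fan_family_minor k : 0 < k -> has_fan e W k ->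
  topological_minor (Fan [set o0] k) (graph_on e W).
Proof.
move=> k0 [x xW [P [kP dP PW]]]; have [A [AP Adisj]] := family_index kP dP.
have data i : exists d : T * T * T * seq T,
    let: (a, b, c, q) := d in [/\ e a b, e a c, path e b (rcons q c),
      uniq (a :: b :: rcons q c) & a = x /\ all [in A i] (b :: rcons q c)].
  have [AW cA /card_gt1P[y [z []]]] := PW _ (AP i).
  rewrite !inE => /andP[yA xy] /andP[zA xz] yz.
  have [q [pq qU qA _]] := connect_restrict_path (cA _ _ yA zA) yA yz.
  have qAx : all [in A i] (y :: rcons q z) by rewrite /= yA all_rcons zA qA.
  exists (x, y, z, q); split=> //.
  rewrite cons_uniq qU andbT; apply/negP => /(allP qAx)/(subsetP AW).
  by rewrite !inE eqxx.
have [d dP'] := fin_all_exists data.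
apply: (@fan_minor _ e W [set o0] k (fun i => triple (d i)) (fun i => (d i).2) A eS eI (Ordinal k0)).
- by rewrite inE.
- move=> i j s /set1P->; move: (dP' i) (dP' j); rewrite /triple.
  by case: (d i) (d j) => [[[a b] c] q] [[[a' b'] c'] q'] /= [_ _ _ _ [-> _]] [_ _ _ _ [-> _]].
- move=> i s /set1P->; move: (dP' i); rewrite /triple.
  case: (d i) => [[[a b] c] q] /= [_ _ _ _ [-> _]]; split=> // j.
  by have [AW _ _] := PW _ (AP j); apply/negP => /(subsetP AW); rewrite !inE eqxx.
- move=> i s; rewrite inE; move: (dP' i); case: (d i) => [[[a b] c] q] /= [_ _ _ _ [_]].
  rewrite /triple all_rcons => /and3P[bA cA _].
  by case: (ord3P s) => -> //; rewrite eqxx.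
- move=> i; move: (dP' i); case: (d i) => [[[a b] c] q] /= [_ _ _ _ [_]].
  by rewrite all_rcons => /and3P[].
- by move=> i; have [AW _ _] := PW _ (AP i); apply: subset_trans AW (subsetDl _ _).
- exact: Adisj.
- by move=> i; move: (dP' i); case: (d i) => [[[a b] c] q] /= [].
Qed.

(** The spine is [o0 o1], and each page supplies as [o2] a neighbour [t] of [x]; the path from [u]
    through the page to [t] replaces the edge [o1 o2]. *)
Lemma adjacent_book_minor k (x u : T) (P : {set {set T}}) : 0 < k -> x \in W -> u \in W -> e x u ->
  k <= #|P| -> disjoint_family P -> {in P, forall A : {set T},
    [/\ A \subset W :\ x :\ u, connected e A, exists2 y, y \in A & e u y
      & exists2 y, y \in A & e x y]} ->
  topological_minor (Fan [set o0; o1] k) (graph_on e W).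
Proof.
move=> k0 xW uW xu kP dP PW; have [A [AP Adisj]] := family_index kP dP.
have Ax i : x \notin A i /\ u \notin A i.
  have [AW _ _ _] := PW _ (AP i).
  by split; apply/negP => /(subsetP AW); rewrite !inE eqxx ?andbF.
have data i : exists d : T * T * T * seq T,
    let: (a, b, c, q) := d in [/\ e a b, e a c, path e b (rcons q c),
      uniq (a :: b :: rcons q c) & [/\ a = x, b = u & all [in A i] (rcons q c)]].
  have [AW cA [w wA uw] [t tA xt]] := PW _ (AP i).
  have [xA uA] := Ax i.
  have xNu : x != u by apply: contraTneq xu => ->; rewrite eI.
  have [p [pe pU pA tE]] := connect_restrictP _ _ wA (cA _ _ wA tA).
  have [q qE] : exists q, w :: p = rcons q t by exists (belast w p); rewrite lastI tE.
  have qA : all [in A i] (rcons q t) by rewrite -qE /= wA.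
  exists (x, u, t, q); split=> //; first by rewrite -qE /= uw.
  rewrite !cons_uniq in_cons negb_or xNu -qE pU andbT /= qE.
  by apply/andP; split; [apply: contra xA | apply: contra uA]; move=> /(allP qA).
have [d dP'] := fin_all_exists data.
apply: (@fan_minor _ e W [set o0; o1] k (fun i => triple (d i)) (fun i => (d i).2) A eS eI (Ordinal k0)).
- by rewrite !inE.
- move=> i j s sE; move: (dP' i) (dP' j); rewrite /triple.
  case: (d i) (d j) => [[[a b] c] q] [[[a' b'] c'] q'] /= [_ _ _ _ [-> -> _]] [_ _ _ _ [-> -> _]].
  by case/set2P: sE => ->.
- move=> i s sE; move: (dP' i); rewrite /triple.
  case: (d i) => [[[a b] c] q] /= [_ _ _ _ [-> -> _]].
  by case/set2P: sE => -> /=; split=> // j; case: (Ax j).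
- move=> i s; rewrite !inE; move: (dP' i); case: (d i) => [[[a b] c] q] /= [_ _ _ _ [_ _]].
  rewrite /triple all_rcons => /andP[cA _].
  by case: (ord3P s) => -> //; rewrite ?eqxx ?orbT.
- move=> i; move: (dP' i); case: (d i) => [[[a b] c] q] /= [_ _ _ _ [_ _]].
  by rewrite all_rcons => /andP[].
- move=> i; have [AW _ _] := PW _ (AP i).
  by move=> _; apply: subset_trans AW (subset_trans (subsetDl _ _) (subsetDl _ _)).
- exact: Adisj.
- by move=> i; move: (dP' i); case: (d i) => [[[a b] c] q] /= [].
Qed.

End Minors.

(* One of the k + 1 pages of the book is spent on the edge joining its spine.  *)
Lemma book_family_minor (T : finType) (e : rel T) W k :
  symmetric e -> irreflexive e -> 0 < k -> has_book e W k.+1 ->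
  exists2 G, topological_minor G (graph_on e W) & topological_minor (Fan [set o0; o1] k) G.
Proof.
move=> eS eI k0 [x [u [xW uW xNu [P [kP dP PW]]]]].
have /card_gt0P[A0 A0P] : 0 < #|P| by apply: leq_trans kP.
have [AW cA [w wA uw] [t tA xt]] := PW _ A0P.
have [p [pe pU pA wE]] := connect_restrictP _ _ tA (cA _ _ tA wA).
pose q := t :: p; have qA : all [in A0] q by rewrite /= tA.
have NA v B : B \in P -> v \in B -> [/\ v \in W, v != x & v != u].
  by move=> /PW[BW _ _ _] /(subsetP BW); rewrite !inE => /and3P[].
have qN v : v \in q -> [/\ v \in W, v != x & v != u].
  by move=> vq; apply: NA A0P _; apply: (allP qA).
exists (graph_on (add_edge e x u) (W :\: [set y in q])).
  apply: topological_minor_add_edge => //.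
  - by apply/allP => v /qN[].
  - rewrite cons_uniq mem_rcons inE negb_or xNu rcons_uniq pU andbT /=.
    by apply/andP; split; apply/negP => /qN[]; rewrite eqxx.
  - by rewrite /= xt rcons_path pe -wE eS.
have [fS fI] := (add_edge_sym eS x u, add_edge_irr eI x u).
apply: (@adjacent_book_minor _ _ _ fS fI k x u (P :\ A0)) => //.
- by rewrite in_setD xW andbT inE; apply/negP => /qN[]; rewrite eqxx.
- by rewrite in_setD uW andbT inE; apply/negP => /qN[]; rewrite eqxx.
- by rewrite /add_edge xNu eqxx orbT.
- by move: kP; rewrite (cardsD1 A0) A0P.
- by move=> B C /setD1P[_ BP] /setD1P[_ CP]; apply: dP.
move=> B /setD1P[BA0 BP]; have [BW cB [y yB uy] [z zB xz]] := PW _ BP.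
split.
- apply/subsetP => v vB; have [vW vx vu] := NA _ _ BP vB; rewrite !in_setD1 vx vu in_setD vW.
  rewrite inE !andbT /=; apply/negP => /(allP qA) vA.
  by have := disjointFr (dP _ _ BP A0P BA0) vB; rewrite vA.
- move=> s r sB rB; apply: connect_mono (cB _ _ sB rB).
  by apply: restrictS => // a b ab; rewrite /add_edge ab.
- by exists y; rewrite // /add_edge uy.
- by exists z; rewrite // /add_edge xz.
Qed.

(** * The three parameters *)

Lemma forest_subgraphP (G : sgraph) (H : subgraph G) (e : rel G) : acyclic e ->
  (forall x y, [set x; y] \in sub_edge H -> e x y) -> forest H.
Proof.
move=> eA He c [c2 cU cc]; apply: (eA (map val c)); split; rewrite ?size_map //.
  by rewrite (map_inj_uniq val_inj).
by apply: homo_cycle cc => x y; apply: He.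
Qed.

Lemma forest_induced (G : sgraph) (B : {set G}) : acyclic (restrict (@adj G) B) -> forest (induced B).
Proof.
move=> eA c [c2 cU cc]; apply: (eA (map val c)); split; rewrite ?size_map //.
  by rewrite (map_inj_uniq val_inj).
by apply: homo_cycle cc => x y xy; rewrite /restrict (valP x) (valP y) !andbT.
Qed.

Lemma induced_acyclic (G : sgraph) (B : {set G}) : forest (induced B) -> acyclic (restrict (@adj G) B).
Proof.
move=> fB c [c2 cU cc].
have cB : all [in B] c.
  apply/allP => x /rot_to[i s cE]; move: cc; rewrite -(rot_cycle i _ c) cE /= .
  by case: s {cE} => [|y s] /= /andP[/and3P[]].
have cE : map val (pmap insub c : seq (induced B)) = c := map_val_insub _ cB.
move: c2 cU cc; rewrite -cE size_map (map_inj_uniq val_inj) => c2 cU cc.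
apply: (fB (pmap insub c : seq (induced B))); split=> //.
by move: cc; rewrite cycle_map; apply: sub_cycle => x y /and3P[].
Qed.

(** The edges in [X] form a feedback edge set, phrased through subgraphs to match the capacity. *)
Definition hits_cycles (G : sgraph) (X : {set {set G}}) : Prop :=
  forall H : subgraph G, [disjoint sub_edge H & X] -> forest H.

(** Each member contains an edge of [X], and disjointness makes these edges distinct. *)
Lemma disjoint_subgraphs_le (G : sgraph) (X : {set {set G}}) l (H : 'I_l -> subgraph G) :
  hits_cycles X -> (forall i j, i != j -> [disjoint sub_edge (H i) & sub_edge (H j)]) ->
  (forall i, ~ forest (H i)) -> l <= #|X|.
Proof.
move=> hX dH cH.
have /fin_all_exists[x xP] i : exists x, (x \in sub_edge (H i)) && (x \in X).
  apply: contrapT => /forallNP no; apply: (cH i); apply: hX.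
  rewrite disjoint_subset; apply/subsetP => x xH; rewrite inE; apply/negP => xX.
  by apply: (no x); rewrite xH.
have x_inj : injective x.
  move=> i j E; apply/eqP; apply: contraT => /dH d.
  have /andP[xi _] := xP i; have /andP[xj _] := xP j.
  by have := disjointFr d xi; rewrite E xj.
rewrite -[l]card_ord -(card_imset _ x_inj); apply/subset_leq_card/subsetP => _ /imsetP[i _ ->].
by case/andP: (xP i).
Qed.

Lemma capacityP (G : sgraph) l (H : 'I_l -> subgraph G) :
  (forall i j, i != j -> [disjoint sub_edge (H i) & sub_edge (H j)]) ->
  (forall i, ~ forest (H i)) -> l <= capacity forest G.
Proof.
move=> dH cH; have [||_] := @maximumP (fun l => exists H : 'I_l -> subgraph G,
  (forall i j, i != j -> [disjoint sub_edge (H i) & sub_edge (H j)]) /\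
  (forall i, ~ forest (H i))) #|edges G|.
- by exists l, H.
(* The set of all edges hits every cycle, which gives the upper bound that [maximumP] needs. *)
- move=> n [K [dK cK]]; apply: disjoint_subgraphs_le dK cK => K' dK'.
  apply: (@forest_subgraphP _ _ (fun _ _ => false)); first by move=> [|x [|y c]] [].
  move=> x y xyK; have := disjointFr dK' xyK.
  by rewrite (subsetP (sub_edge_edges K') _ xyK).
- by apply; exists H.
Qed.

Lemma capacity_le (G : sgraph) (X : {set {set G}}) : hits_cycles X -> capacity forest G <= #|X|.
Proof.
move=> hX; pose Q l := exists H : 'I_l -> subgraph G,
  (forall i j, i != j -> [disjoint sub_edge (H i) & sub_edge (H j)]) /\
  (forall i, ~ forest (H i)).
have Qb n : Q n -> n <= #|X| by move=> [K [dK cK]]; apply: disjoint_subgraphs_le dK cK.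
have Q0 : exists n, Q n.
  have H0 : 'I_0 -> subgraph G by case.
  by exists 0, H0; split=> -[].
by have [/Qb] := maximumP Q0 Qb.
Qed.

Lemma capacity_le_edit_distance (G : sgraph) :
  capacity forest G <= edit_distance forest G.
Proof.
pose Q l := exists (e : rel G) (e_sym : symmetric e) (e_irr : irreflexive e),
  forest (SGraph e_sym e_irr) /\
  #|(edges (SGraph e_sym e_irr) :\: edges G) :|: (edges G :\: edges (SGraph e_sym e_irr))| = l.
have [|[e [eS [eI [fe mE]]]] _] := @minimumP Q.
  (* The edgeless graph is a competitor, so [minimum] is a genuine minimum and not the default. *)
  have nS : symmetric (fun _ _ : G => false) by [].
  have nI : irreflexive (fun _ : G => xpred0) by [].
  by eexists; exists (fun _ _ => false), nS, nI; split=> // -[|x [|y c]] [].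
rewrite -[edit_distance _ _]/(minimum Q) -mE.
apply: leq_trans (subset_leq_card (subsetUr _ _)); apply: capacity_le => H dH.
apply: (@forest_subgraphP G H e fe) => x y xyH; have := disjointFr dH xyH.
rewrite in_setD (subsetP (sub_edge_edges H) _ xyH) andbT => /negbFE.
by rewrite (@mem_edges (SGraph eS eI)).
Qed.

(** A cycle without crossing edges stays inside one block, whose induced subgraph is a forest. *)
Lemma capacity_le_edge_brittleness (G : sgraph) :
  capacity forest G <= edge_brittleness forest G.
Proof.
pose Q l := exists P : {set {set G}}, [/\ partition P [set: G],
  forall B, B \in P -> forest (induced B)
  & #|[set e in edges G | [exists x in e, exists y in e, pblock P x != pblock P y]]| = l].
have [|[P [Ppart Pf mE]] _] := @minimumP Q.
  (* The partition into singletons is a competitor. *)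
  eexists; exists (preim_partition id [set: G]); split; [exact: preim_partitionP | | by []].
  move=> _ /imsetP[x _ ->]; apply/forest_induced => -[|y [|z c]] [] //= _.
  rewrite inE negb_or => /andP[/andP[yz _] _] /andP[/and3P[_ + +] _].
  by rewrite !inE /= => /eqP xy /eqP xz; rewrite -xy -xz eqxx in yz.
rewrite -[edge_brittleness _ _]/(minimum Q) -mE; apply: capacity_le => H dH c [c2 cU cc].
have sameblock x y : [set x; y] \in sub_edge H -> pblock P x = pblock P y.
  move=> xyH; have := disjointFr dH xyH; rewrite inE (subsetP (sub_edge_edges H) _ xyH) /=.
  move/negbT/exists_inPn/(_ x (set21 x y))/exists_inPn/(_ y (set22 x y)).
  by rewrite negbK => /eqP.
case: c c2 cU cc => // x c c2 cU cc.
have BP : pblock P (val x) \in P.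
  by apply: pblock_mem; rewrite (cover_partition Ppart).
have xc : {in x :: c, forall y, pblock P (val y) = pblock P (val x)}.
  pose r := [rel u v : H | pblock P (val u) == pblock P (val v) :> {set G}].
  have rT : transitive r by move=> u v w /= /eqP-> /eqP->.
  have /(order_path_min rT)/allP rc : path r x (rcons c x).
    by apply: sub_path cc => u v /sameblock/eqP.
  by move=> y yc; apply/esym/eqP/rc; rewrite mem_rcons.
apply: (induced_acyclic (Pf _ BP) (c := map val (x :: c))); split; rewrite ?size_map //.
  by rewrite (map_inj_uniq val_inj).
rewrite cycle_map; apply: (sub_in_cycle (P := [in x :: c])) cc => [u v uc vc uv|]; last exact/allP.
rewrite /= /restrict -mem_edges (subsetP (sub_edge_edges H) _ uv) /= -{1}(xc _ uc) -(xc _ vc).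
by rewrite !mem_pblock (cover_partition Ppart) !in_setT.
Qed.

Lemma topological_minor_refl (G : sgraph) : topological_minor G G.
Proof.
apply: (@topological_minorI G G id (fun _ _ => [::])) => //= x y xy.
rewrite xy; split=> //; rewrite inE andbT.
by apply: contraTneq xy => ->; rewrite adj_irr.
Qed.

Lemma graph_on_setT (G : sgraph) : isomorphic G (graph_on (@adj G) [set: G]).
Proof.
exists (fun x => exist _ x (in_setT x)) => [|x y].
  by exists val => // x; apply: val_inj.
by rewrite graph_onE //; [apply: adj_sym | apply: adj_irr].
Qed.

(** * Edge-disjoint cycles in fans *)

Section Fan_capacity.
Variables (S : {set complete 3}) (k : nat).

Let F := Fan S (2 * k).

(** Halving the index pairs copy [2 * j] with copy [2 * j + 1]. *)
Let copy (u : F) : option nat := match u with inl _ => None | inr r => Some (val r.1)./2 end.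

(** A private end is required because an edge inside [S] would belong to every pair of copies. *)
Let E (j : 'I_k) : {set {set F}} :=
  [set s in edges F | [exists u in s, copy u == Some (val j)]].

Let E_edges j : E j \subset edges F.
Proof. by apply/subsetP => s; rewrite inE => /andP[]. Qed.

Let mem_E j u v : ([set u; v] \in E j) =
  adj u v && ((copy u == Some (val j)) || (copy v == Some (val j))).
Proof.
rewrite inE mem_edges; congr andb; apply/exists_inP/orP => [[w]|[uj|vj]].
- by case/set2P => ->; auto.
- by exists u; rewrite ?set21.
- by exists v; rewrite ?set22.
Qed.

Let E_disjoint i j : i != j -> [disjoint E i & E j].
Proof.
move=> ij; rewrite disjoint_subset; apply/subsetP => s si; rewrite inE; apply/negP => sj.
have /imsetP[[u v]] := subsetP (E_edges i) _ si; rewrite inE => uv sE.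
move: si sj; rewrite sE !mem_E => /andP[_ ui] /andP[_ uj].
case/negP: ij; rewrite -val_eqE.
case: u v uv ui uj {sE} => [a|[a x]] [b|[b y]] //= /andP[_ ab];
  rewrite ?(eqP (ab : a == b)) ?orbb ?orbF => /eqP[<-] /eqP[<-]; exact: eqxx.
Qed.

Let H j : subgraph F := @Subgraph F [set: F] (E j) (E_edges j) (subsetT _).

Let vtx (i : 'I_(2 * k)) (x : complete 3) : F :=
  match boolP (x \in S) with
  | AltTrue xS => inl (exist _ x xS)
  | AltFalse xS => inr (i, exist _ x xS)
  end.

Let vtx_base i x : fan_base (vtx i x) = x.
Proof. by rewrite /vtx; case: {-}_ / boolP. Qed.

Let vtx_adj i j x y : adj (vtx i x) (vtx j y) = (x != y) && [|| x \in S, y \in S | i == j].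
Proof.
rewrite /= /fan_adj !vtx_base /=; congr andb.
by rewrite /vtx; case: {-}_ / boolP => xS; case: {-}_ / boolP => yS; rewrite /= ?(negPf xS) ?(negPf yS) ?xS ?yS ?orbT.
Qed.

Let vtx_copy i x : x \notin S -> copy (vtx i x) = Some i./2.
Proof. by move=> xS; rewrite /vtx; case: {-}_ / boolP => // xS'; rewrite xS' in xS. Qed.

Let vtx_inj i j x : x \notin S -> vtx i x = vtx j x -> i = j.
Proof. by move=> xS; rewrite /vtx; case: {-}_ / boolP => [xS'|xS' []//]; rewrite xS' in xS. Qed.

Let not_forest_H j (c : seq F) : 2 < size c -> uniq c ->
  cycle (fun u v => [set u; v] \in E j) c -> ~ forest (H j).
Proof.
move=> c2 cU cc fH; apply: (fH (map (fun u => exist _ u (in_setT u)) c)); split.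
- by rewrite size_map.
- by rewrite map_inj_uniq // => u v [].
- by rewrite cycle_map.
Qed.

(** If the copies share an edge, the [j]-th pair of copies contains a 4-cycle avoiding it, through
    the two shared vertices and the two private ones. Otherwise the triangle of copy [2 * j] will
    do. *)
Lemma capacity_fan : #|S| <= 2 -> k <= capacity forest F.
Proof.
move=> S2; apply: (@capacityP F k H) => [i j|j]; first exact: E_disjoint.
have lt0 : 2 * j < 2 * k by rewrite ltn_mul2l ltn_ord.
have lt1 : (2 * j).+1 < 2 * k by have := ltn_ord j; lia.
pose i0 := Ordinal lt0; pose i1 := Ordinal lt1.
have h0 : i0./2 = val j by rewrite /= mul2n doubleK.
have h1 : i1./2 = val j by rewrite /= mul2n uphalf_double.
move: S2; rewrite leq_eqVlt => /predU1P[/eqP/cards2P[a [b [ab SE]]]|S1].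
  have [w wS] : exists w, w \notin S.
    apply/existsP; apply: contraT => /existsPn SA.
    have : [set: complete 3] \subset S by apply/subsetP => x _; have := SA x; rewrite negbK.
    by move/subset_leq_card; rewrite cardsT card_ord SE cards2 ab.
  have [aS bS] : a \in S /\ b \in S by rewrite SE set21 set22.
  have [aw bw] : a != w /\ b != w by split; apply: contraNneq wS => <-.
  apply: (@not_forest_H j [:: vtx i0 a; vtx i0 w; vtx i0 b; vtx i1 w]) => //.
    have N i i' x y : x != y -> vtx i x != vtx i' y.
      by move=> xy; apply: contraNneq xy => xyE; rewrite -(vtx_base i x) xyE vtx_base.
    have Nw : vtx i0 w != vtx i1 w.
      by apply/eqP => /(vtx_inj wS)/eqP; rewrite -val_eqE /= eq_sym eqn_leq ltnn.
    have wb : w != b by rewrite eq_sym.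
    by rewrite !cons_uniq !in_cons !negb_or Nw !N.
  have E4 i (i' : 'I_(2 * k)) x : i'./2 = j -> x \in S -> [set vtx i x; vtx i' w] \in E j.
    move=> i'j xS; rewrite mem_E vtx_adj xS (vtx_copy _ wS) i'j eqxx orbT !andbT.
    by apply: contraNneq wS => <-.
  by rewrite /= ![[set vtx _ w; _]]setUC !E4.
have NS x y : x != y -> (x \notin S) || (y \notin S).
  move=> xy; rewrite -negb_and; apply/negP => /andP[xS yS].
  suff : 1 < #|S| by rewrite ltnNge -ltnS S1.
  by apply/card_gt1P; exists x, y.
apply: (@not_forest_H j [:: vtx i0 o0; vtx i0 o1; vtx i0 o2]) => //.
  have N x y : x != y -> vtx i0 x != vtx i0 y.
    by apply: contraNneq => E'; rewrite -(vtx_base i0 x) E' vtx_base.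
  by rewrite !cons_uniq !in_cons !negb_or !N.
have E2 x y : x != y -> [set vtx i0 x; vtx i0 y] \in E j.
  move=> xy; rewrite mem_E vtx_adj xy eqxx !orbT /=.
  have /orP[xS|yS] := NS _ _ xy; first by rewrite (vtx_copy i0 xS) h0 eqxx.
  by rewrite (vtx_copy i0 yS) h0 eqxx orbT.
by rewrite /= !E2.
Qed.

End Fan_capacity.

(** * From few deletions to edit distance and brittleness *)

Section Cut.
Variables (T : finType).

(** The path joining two vertices of a forest is unique, so removing its first edge separates them;
    each member of [R] costs at most one edge, that is, two ordered pairs. *)
Lemma cut_forest (f : rel T) (R : seq (T * T)) :
  symmetric f -> irreflexive f -> acyclic f -> exists h : rel T,
    [/\ symmetric h, subrel h f, #|[set p | f p.1 p.2 && ~~ h p.1 p.2]| <= 2 * size R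
      & {in R, forall p, p.1 != p.2 -> ~~ connect h p.1 p.2}].
Proof.
move=> fS fI fA; elim: R => [|[x y] R [h [hS hf hR hc]]].
  by exists f; split=> //; rewrite eq_card0 // => p; rewrite !inE andbN.
have [nc|/negPn/andP[xy cxy]] := boolP (~~ ((x != y) && connect h x y)).
  exists h; split=> //; first by apply: leq_trans hR _; rewrite leq_mul2l leqnSn orbT.
  move=> p; rewrite inE => /predU1P[->/= xy|]; last exact: hc.
  by apply: contra nc => ->; rewrite xy.
have [z hxz czy] := connect_step cxy xy.
pose h' := [rel u v | h u v && ([set u; v] != [set x; z])].
have h'S : symmetric h' by move=> u v; rewrite /= hS setUC.
have hI : irreflexive h by move=> u; apply/negP => /hf; rewrite fI.
have h'h : subrel h' h by move=> u v /andP[].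
exists h'; split=> //; first by move=> u v /h'h/hf.
  rewrite /= mulnS addnC; apply: leq_trans (leq_add hR (leqnn 2)).
  have c2 : #|[set (x, z); (z, x)]| <= 2 by rewrite cards2; case: (_ != _).
  apply: leq_trans (leq_add (leqnn _) c2); apply: leq_trans (leq_card_setU _ _).
  apply/subset_leq_card/subsetP => -[u v]; rewrite !inE /= => /andP[-> ].
  rewrite negb_and negbK => /orP[-> //|/eqP/set2_inj[[-> ->]|[-> ->]]]; by rewrite eqxx ?orbT.
move=> [u v] /predU1P[[-> ->] /= _|uvR uv]; last first.
  by apply: contra (hc _ uvR uv); apply: connect_mono.
apply/negP => cxy'; have [w /andP[hxw xw] cwy] := connect_step cxy' xy.
have hA : acyclic h by apply: acyclic_sub fA.
move: xw; rewrite (_ : w = z) ?eqxx //; apply: (acyclic_nbrs hA hS hI hxw hxz).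
have cwy' : connect (restrict h [set~ x]) w y.
  by apply: connect_mono cwy; apply: restrictS.
apply: connect_trans cwy' _.
by rewrite (sym_connect_sym (restrict_sym _ hS)).
Qed.

End Cut.

Lemma edit_distance_le (G : sgraph) g : forest_up_to (@adj G) [set: G] g ->
  edit_distance forest G <= g.
Proof.
move=> [f [fS fW fA fg]].
have fI : irreflexive f by move=> x; apply/negP => /fW/and3P[]; rewrite adj_irr.
pose Q l := exists (e : rel G) (e_sym : symmetric e) (e_irr : irreflexive e),
  forest (SGraph e_sym e_irr) /\
  #|(edges (SGraph e_sym e_irr) :\: edges G) :|: (edges G :\: edges (SGraph e_sym e_irr))| = l.
set l := #|(edges (SGraph fS fI) :\: edges G) :|: (edges G :\: edges (SGraph fS fI))|.
have Ql : Q l by exists f, fS, fI.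
have [_ /(_ _ Ql) ml] := @minimumP Q (ex_intro _ _ Ql).
apply: leq_trans ml (leq_trans _ fg).
apply: leq_trans (leq_imset_card (fun p => [set p.1; p.2]) _).
apply/subset_leq_card/subsetP => s /setUP[]/setDP[/imsetP[[x y]]]; rewrite inE /= => xy ->.
  rewrite mem_edges; by case/and3P: (fW _ _ xy) => ->.
rewrite (@mem_edges (SGraph fS fI)) /= => Nxy; apply/imsetP; exists (x, y) => //.
by rewrite inE /= /restrict xy !inE.
Qed.

(** The components of [f] need not induce forests, since a deleted edge may have both ends in one of
    them. Separating the ends of all deleted edges repairs this: a crossing edge is one of the at
    most [g] deleted pairs or of the at most [2 * g] pairs cut from [f]. *)
Lemma edge_brittleness_le (G : sgraph) g : forest_up_to (@adj G) [set: G] g ->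
  edge_brittleness forest G <= 3 * g.
Proof.
move=> [f [fS fW fA fg]].
have fI : irreflexive f by move=> x; apply/negP => /fW/and3P[]; rewrite adj_irr.
set R := [set p | _] in fg.
have [h [hS hf hc hR]] := cut_forest (enum R) fS fI fA.
pose Q l := exists P : {set {set G}}, [/\ partition P [set: G],
  forall B, B \in P -> forest (induced B)
  & #|[set e in edges G | [exists x in e, exists y in e, pblock P x != pblock P y]]| = l].
have heq : {in [set: G] & &, equivalence_rel (connect h)}.
  move=> x y z _ _ _; split=> [|xy]; first exact: connect0.
  by rewrite (same_connect (sym_connect_sym hS) xy).
pose P := equivalence_partition (connect h) [set: G].
have Ppart : partition P [set: G] := equivalence_partitionP heq.
have Pblock x y : (y \in pblock P x) = connect h x y.
  by rewrite pblock_equivalence_partition.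
have adj_cut x y : adj x y -> connect h x y -> f x y.
  move=> xy; apply: contraTT => Nf; apply: (hR (x, y)).
    by rewrite mem_enum inE /= Nf /restrict xy !inE.
  by apply: contraTneq xy => /= ->; rewrite adj_irr.
set l := #|[set e in edges G | [exists x in e, exists y in e, pblock P x != pblock P y]]|.
have Ql : Q l.
  exists P; split=> // B BP; apply: forest_induced; apply: acyclic_sub fA => x y /and3P[xy xB yB].
  apply: adj_cut => //; rewrite -Pblock.
  have /and3P[_ tP _] := Ppart.
  by rewrite (def_pblock tP BP xB).
have [_ /(_ _ Ql) ml] := @minimumP Q (ex_intro _ _ Ql).
apply: leq_trans ml _; rewrite mulSn.
have hc' : #|[set p | f p.1 p.2 && ~~ h p.1 p.2]| <= 2 * g.
  by apply: leq_trans hc _; rewrite leq_mul2l -cardE.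
apply: leq_trans (leq_add fg hc').
apply: leq_trans (leq_card_setU _ _); apply: leq_trans (leq_imset_card (fun p => [set p.1; p.2]) _).
apply/subset_leq_card/subsetP => s; rewrite inE => /andP[/imsetP[[a b]]].
rewrite inE /= => ab -> /exists_inP[x xab /exists_inP[y yab xy]].
apply/imsetP; exists (a, b) => //; rewrite !inE /= /restrict ab !inE /=.
case: (boolP (f a b)) => //= fab; apply: contra xy => hab.
have tP : trivIset P by case/and3P: Ppart.
have bE : pblock P a = pblock P b by apply/esym/same_pblock => //; rewrite Pblock connect1.
by case/set2P: xab => ->; case/set2P: yab => ->; rewrite ?bE.
Qed.

(** * Excluded fans and the equivalence *)

Lemma excluded_fan (Gs : graph_class) (S : {set complete 3}) : ideal Gs ->
  ~ subclass (FAN S) Gs -> exists2 k, 0 < k & ~ Gs (Fan S k).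
Proof.
move=> [_ minor] /existsNP[H /not_implyP[[k [k0 Hk]] NH]]; exists k => // Gk.
by apply: NH; apply: minor Gk Hk.
Qed.

Lemma forest_up_to_excluded_fans (Gs : graph_class) : ideal Gs ->
  (forall S : {set complete 3}, #|S| <= 2 -> ~ subclass (FAN S) Gs) ->
  exists g, forall G, Gs G -> forest_up_to (@adj G) [set: G] g.
Proof.
move=> Gs_ideal Gs_fans; have [Gs_iso Gs_minor] := Gs_ideal.
have [kd kd0 Nd] : exists2 k, 0 < k & ~ Gs (Fan (set0 : {set complete 3}) k).
  by apply: excluded_fan => //; apply: Gs_fans; rewrite cards0.
have [kf kf0 Nf] : exists2 k, 0 < k & ~ Gs (Fan [set o0] k).
  by apply: excluded_fan => //; apply: Gs_fans; rewrite cards1.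
have [kb kb0 Nb] : exists2 k, 0 < k & ~ Gs (Fan [set o0; o1] k).
  by apply: excluded_fan => //; apply: Gs_fans; rewrite cards2; case: (_ != _).
have no_fan (T : finType) (e : rel T) W : symmetric e -> irreflexive e ->
    Gs (graph_on e W) -> ~ has_fan e W kf.
  by move=> eS eI GW fan; apply: Nf; apply: Gs_minor GW _; apply: fan_family_minor.
(* The successor accounts for the page that [book_family_minor] spends on the spine. *)
have no_book (T : finType) (e : rel T) W : symmetric e -> irreflexive e ->
    Gs (graph_on e W) -> ~ has_book e W kb.+1.
  move=> eS eI GW /(book_family_minor eS eI kb0)[G GM FG].
  by apply: Nb; apply: (Gs_minor _ _ (Gs_minor _ _ GW GM) FG).
have [g pk] := bounded_or_disjoint_cycles Gs_minor no_fan no_book kd.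
exists g => G GG.
have GT : Gs (graph_on (@adj G) [set: G]) := Gs_iso _ _ GG (graph_on_setT G).
have [//|cyc] := pk _ _ _ (@adj_sym G) (@adj_irr G) GT.
case: Nd; apply: Gs_minor GT _.
by apply: disjoint_cycles_minor => //; [apply: adj_sym | apply: adj_irr].
Qed.

Theorem theorem1p2 (Gs : graph_class) (hGs : ideal Gs) :
  [<-> bounded_on (capacity forest) Gs;
       bounded_on (edit_distance forest) Gs;
       bounded_on (edge_brittleness forest) Gs;
       forall S : {set complete 3}, #|S| <= 2 -> ~ subclass (FAN S) Gs].
Proof.
have capacity_fans : bounded_on (capacity forest) Gs ->
    forall S : {set complete 3}, #|S| <= 2 -> ~ subclass (FAN S) Gs.
  (* A fan with [M.+1] pairs of copies exceeds the bound [M]. *)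
  move=> [M capM] S S2 FS; have := capacity_fan M.+1 S2; rewrite leqNgt ltnS capM //.
  by apply: FS; exists (2 * M.+1); split=> //; apply: topological_minor_refl.
tfae.
- move=> /capacity_fans/(forest_up_to_excluded_fans hGs)[g gP].
  by exists g => G /gP/edit_distance_le.
- move=> [M editM].
  have /capacity_fans/(forest_up_to_excluded_fans hGs)[g gP] :
      bounded_on (capacity forest) Gs.
    by exists M => G /editM; apply: leq_trans (capacity_le_edit_distance G).
  by exists (3 * g) => G /gP/edge_brittleness_le.
- move=> [M britM]; apply: capacity_fans; exists M => G /britM.
  exact: leq_trans (capacity_le_edge_brittleness G).
- move=> /(forest_up_to_excluded_fans hGs)[g gP]; exists g => G /gP/edit_distance_le.
  exact: leq_trans (capacity_le_edit_distance G).
Qed.
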